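(* Let $\mathscr H$ be a complex Hilbert space of dimension $4$ and let $\mathcal S=(\gamma_1,\gamma_2)$ be a pair of weighted density operators on $\mathscr H$ with $\operatorname{supp}\gamma_1\cap\operatorname{supp}\gamma_2=\{0\}$, $\ker\gamma_1\cap\ker\gamma_2=\{0\}$, $\operatorname{supp}\gamma_1\cap\ker\gamma_2=\{0\}$ and $\ker\gamma_1\cap\operatorname{supp}\gamma_2=\{0\}$. Then the optimal USD measurement $(E_1,E_2,E_?)$ of $\mathcal S$ satisfies $\operatorname{rank}E_1=1$ and $\operatorname{rank}E_2=2$ if and only if there exists an orthonormal basis $(|\phi\rangle,|\phi^\perp\rangle)$ of $\operatorname{supp}\gamma_1$ such that $$\langle\phi|\gamma_2-\gamma_1|\phi\rangle\ge 0,$$ $$\sqrt{\langle\phi^\perp|\gamma_1|\phi^\perp\rangle}\;\langle\phi^\perp|\gamma_2|\phi\rangle=\sqrt{\langle\phi^\perp|\gamma_2|\phi^\perp\rangle}\;\langle\phi^\perp|\gamma_1|\phi\rangle,$$ $$\langle\phi^\perp|K^\dagger K|\phi^\perp\rangle<1,$$ where $$K=(\gamma_1+\gamma_2)^{-1}\left(\sqrt{r}\,\gamma_1+\tfrac{1}{\sqrt r}\,\gamma_2\right),\qquad r=\sqrt{\frac{\langle\phi^\perp|\gamma_2|\phi^\perp\rangle}{\langle\phi^\perp|\gamma_1|\phi^\perp\rangle}} .$$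
   Context: A weighted density operator is a positive semi-definite operator on $\mathscr H$ (no normalization of the trace is required). For a positive semi-definite operator $\rho$, $\operatorname{supp}\rho=(\ker\rho)^\perp$. A USD (unambiguous state discrimination) measurement of $\mathcal S$ is a triple $\mathcal E=(E_1,E_2,E_?)$ of positive semi-definite operators on $\mathscr H$ with $E_1+E_2+E_?=1$ (identity), $\operatorname{tr}(E_2\gamma_1)=0$ and $\operatorname{tr}(E_1\gamma_2)=0$. Its success probability is $\operatorname{tr}(E_1\gamma_1)+\operatorname{tr}(E_2\gamma_2)$; it is optimal if its success probability is maximal among all USD measurements of $\mathcal S$. For pairs $\mathcal S$ with $\ker\gamma_1\cap\ker\gamma_2=\{0\}$ the optimal USD measurement is unique. Under the stated hypotheses $\gamma_1$ and $\gamma_2$ both have rank $2$, $\gamma_1+\gamma_2$ is invertible, and $\langle\phi^\perp|\gamma_\mu|\phi^\perp\rangle>0$ for $\mu=1,2$. *)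

(* Defs.v *)
From mathcomp Require Import all_boot all_order all_algebra.
From mathcomp Require Import sesquilinear.
From mathcomp Require Import complex.
From mathcomp Require Import reals.

Set Implicit Arguments.
Unset Strict Implicit.
Unset Printing Implicit Defensive.

Import Order.TTheory GRing.Theory Num.Theory.
Local Open Scope ring_scope.
Local Open Scope sesquilinear_scope.

(* Kets are column vectors and operators act on them by left multiplication.
   In a numClosedFieldType, [0 <= z], [z < 1], ... force the elements compared
   to differ by a real number, so inequalities between expectation values
   carry the usual meaning for real numbers. *)

Section USD.
Context {C : numClosedFieldType} {n : nat}.
Implicit Types (A : 'M[C]_n) (u v : 'cV[C]_n).

Definition adjoint m p (A : 'M[C]_(m, p)) : 'M[C]_(p, m) := A ^t Num.conj.

(* <u|v>, conjugate-linear in u *)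
Definition braket u v : C := (adjoint u *m v) ord0 ord0.

(* <u|A|v> *)
Definition sandwich u A v : C := braket u (A *m v).

(* Over the complex numbers, [0 <= <v|A|v>] for all v makes A self-adjoint. *)
Definition psd A : Prop := forall v, 0 <= sandwich v A v.

Definition in_ker A v : Prop := A *m v = 0.

Definition in_supp A u : Prop := forall v, in_ker A v -> braket v u = 0.

Definition trivial_meet (P Q : 'cV[C]_n -> Prop) : Prop :=
  forall v, P v -> Q v -> v = 0.

Definition onb2_of (P : 'cV[C]_n -> Prop) u v : Prop :=
  [/\ P u /\ P v,
      [/\ braket u u = 1, braket v v = 1 & braket u v = 0]
    & forall w, P w -> exists a b : C, w = a *: u + b *: v].

(* Eq is the operator E_? of the inconclusive outcome. *)
Definition usd (g1 g2 E1 E2 Eq : 'M[C]_n) : Prop :=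
  [/\ [/\ psd E1, psd E2 & psd Eq],
      E1 + E2 + Eq = 1%:M,
      \tr (E2 *m g1) = 0
    & \tr (E1 *m g2) = 0].

Definition success (g1 g2 E1 E2 : 'M[C]_n) : C :=
  \tr (E1 *m g1) + \tr (E2 *m g2).

Definition optimal_usd (g1 g2 E1 E2 Eq : 'M[C]_n) : Prop :=
  usd g1 g2 E1 E2 Eq /\
  forall F1 F2 Fq : 'M[C]_n, usd g1 g2 F1 F2 Fq ->
    success g1 g2 F1 F2 <= success g1 g2 E1 E2.

(* [sqrtC x] is the nonnegative square root when [0 <= x]. *)
Definition ratio_r (g1 g2 : 'M[C]_n) (phip : 'cV[C]_n) : C :=
  sqrtC (sandwich phip g2 phip / sandwich phip g1 phip).

Definition opK (g1 g2 : 'M[C]_n) (phip : 'cV[C]_n) : 'M[C]_n :=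
  let r := ratio_r g1 g2 phip in
  invmx (g1 + g2) *m (sqrtC r *: g1 + (sqrtC r)^-1 *: g2).

End USD.

(* Main.v *)
(** In orthonormal frames V of supp g1 and W of ker g1, ker g2 is the graph of an
    invertible T, and the measurements are E1 = A X A^H, E2 = W Y W^H with
    A = V + W T.  Put U = 1 - X.  Positivity of E_? is a Schur complement
    condition, so an optimal measurement has Y = 1 + T T^H - T U^-1 T^H, and what
    remains is to minimise the convex function
    tr (U g) + tr (U^-1 k), where g and k are the compressions of g1 and g2 to
    supp g1.  When Y is invertible, U may be varied freely as long as X stays
    positive, hence G = U^-1 k U^-1 - g is positive and G X = 0; conversely these
    two conditions yield a dual certificate which forces every optimal
    measurement to be the given one.  If X = (1 - u) |phi'><phi'| with phi' the
    second basis vector, they read: <phi|g2 - g1|phi> >= 0,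
    <phi'|g2|phi> = u <phi'|g1|phi> and <phi'|g2|phi'> = u^2 <phi'|g1|phi'>, so
    that u = r.  Finally K phi' = sqrt r A e - (1 / sqrt r) W T e with phi' = V e,
    of squared norm r + (1 - r)^2 / r |T e|^2, which is < 1 exactly when r < 1 and
    Y = 1 - (1 / r - 1) |T e><T e| is positive definite. *)

Require Import Defs.
From mathcomp Require Import all_boot all_order all_algebra.
From mathcomp Require Import sesquilinear spectral ring zify.
From mathcomp Require Import complex.
From mathcomp Require Import reals.

Set Implicit Arguments.
Unset Strict Implicit.
Unset Printing Implicit Defensive.

Import Order.TTheory GRing.Theory Num.Theory.
Local Open Scope ring_scope.

Local Notation "A ^H" := (adjoint A) (at level 8, format "A ^H").

(** * Adjoints and positive semi-definite matrices *)

Section Adjoint.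
Context {C : numClosedFieldType}.

Lemma adjointK m n (A : 'M[C]_(m, n)) : A^H^H = A.
Proof. by apply/matrixP=> i j; rewrite !mxE conjCK. Qed.

Lemma adjointM m n p (A : 'M[C]_(m, n)) (B : 'M[C]_(n, p)) :
  (A *m B)^H = B^H *m A^H.
Proof. by rewrite /adjoint trmx_mul map_mxM. Qed.

Lemma adjointD m n (A B : 'M[C]_(m, n)) : (A + B)^H = A^H + B^H.
Proof. by apply/matrixP=> i j; rewrite !mxE rmorphD. Qed.

Lemma adjointN m n (A : 'M[C]_(m, n)) : (- A)^H = - A^H.
Proof. by apply/matrixP=> i j; rewrite !mxE rmorphN. Qed.

Lemma adjointB m n (A B : 'M[C]_(m, n)) : (A - B)^H = A^H - B^H.
Proof. by rewrite adjointD adjointN. Qed.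

Lemma adjointZ m n a (A : 'M[C]_(m, n)) : (a *: A)^H = a^* *: A^H.
Proof. by apply/matrixP=> i j; rewrite !mxE rmorphM. Qed.

Lemma adjoint0 m n : (0 : 'M[C]_(m, n))^H = 0.
Proof. by apply/matrixP=> i j; rewrite !mxE rmorph0. Qed.

Lemma adjoint1 n : (1%:M : 'M[C]_n)^H = 1%:M.
Proof. by rewrite /adjoint trmx1 map_mx1. Qed.

Lemma adjoint_row_mx m n1 n2 (A : 'M[C]_(m, n1)) (B : 'M[C]_(m, n2)) :
  (row_mx A B)^H = col_mx A^H B^H.
Proof. by rewrite /adjoint tr_row_mx map_col_mx. Qed.

Lemma ge0_conj (a : C) : 0 <= a -> a^* = a.
Proof. by move/ger0_real/CrealP. Qed.

End Adjoint.

(** * Inner products and matrix elements of operators *)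

Section Braket.
Context {C : numClosedFieldType}.
Implicit Types (m n : nat).

Lemma braket_mx n (u v : 'cV[C]_n) : u^H *m v = (braket u v)%:M.
Proof. by rewrite /braket [LHS]mx11_scalar. Qed.

Lemma sandwich_mx n (u v : 'cV[C]_n) A : u^H *m A *m v = (sandwich u A v)%:M.
Proof. by rewrite -mulmxA braket_mx. Qed.

Lemma conj_braket n (u v : 'cV[C]_n) : (braket u v)^* = braket v u.
Proof.
rewrite /braket -[in RHS](adjointK u) -adjointM !mxE.
by congr (_^*); apply: eq_bigr => i _; rewrite !mxE.
Qed.

Lemma braketDl n (u v w : 'cV[C]_n) : braket (u + v) w = braket u w + braket v w.
Proof. by rewrite /braket adjointD mulmxDl mxE. Qed.

Lemma braketDr n (u v w : 'cV[C]_n) : braket w (u + v) = braket w u + braket w v.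
Proof. by rewrite /braket mulmxDr mxE. Qed.

Lemma braketZl n a (u v : 'cV[C]_n) : braket (a *: u) v = a^* * braket u v.
Proof. by rewrite /braket adjointZ -scalemxAl mxE. Qed.

Lemma braketZr n a (u v : 'cV[C]_n) : braket u (a *: v) = a * braket u v.
Proof. by rewrite /braket -scalemxAr mxE. Qed.

Lemma braketNl n (u v : 'cV[C]_n) : braket (- u) v = - braket u v.
Proof. by rewrite /braket adjointN mulNmx mxE. Qed.

Lemma braketNr n (u v : 'cV[C]_n) : braket u (- v) = - braket u v.
Proof. by rewrite /braket mulmxN mxE. Qed.

Lemma braket0l n (v : 'cV[C]_n) : braket 0 v = 0.
Proof. by rewrite /braket adjoint0 mul0mx mxE. Qed.

Lemma braket0r n (v : 'cV[C]_n) : braket v 0 = 0.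
Proof. by rewrite /braket mulmx0 mxE. Qed.

Lemma braket_mulr m n (A : 'M[C]_(m, n)) u v :
  braket u (A *m v) = braket (A^H *m u) v.
Proof. by rewrite /braket adjointM adjointK mulmxA. Qed.

Lemma braket_mull m n (A : 'M[C]_(m, n)) u v :
  braket (A *m v) u = braket v (A^H *m u).
Proof. by rewrite braket_mulr adjointK. Qed.

Lemma braket_ge0 n (u : 'cV[C]_n) : 0 <= braket u u.
Proof. by rewrite /braket !mxE sumr_ge0 // => i _; rewrite !mxE mulrC mul_conjC_ge0. Qed.

Lemma braket_eq0 n (u : 'cV[C]_n) : braket u u = 0 -> u = 0.
Proof.
rewrite /braket !mxE => /eqP; rewrite psumr_eq0 => [/allP h|i _]; last first.
  by rewrite !mxE mulrC mul_conjC_ge0.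
apply/matrixP => i j; rewrite ord1 mxE.
have := h i (mem_index_enum _); rewrite !mxE /= mulrC mul_conjC_eq0.
by move/eqP.
Qed.

Lemma braket_gt0 n (u : 'cV[C]_n) : u != 0 -> 0 < braket u u.
Proof.
by move=> u0; rewrite lt0r braket_ge0 andbT; apply: contra u0 => /eqP/braket_eq0->.
Qed.

Lemma sandwichDm n (u v : 'cV[C]_n) A B :
  sandwich u (A + B) v = sandwich u A v + sandwich u B v.
Proof. by rewrite /sandwich mulmxDl braketDr. Qed.

Lemma sandwichNm n (u v : 'cV[C]_n) A : sandwich u (- A) v = - sandwich u A v.
Proof. by rewrite /sandwich mulNmx braketNr. Qed.

Lemma sandwichZm n (u v : 'cV[C]_n) a A : sandwich u (a *: A) v = a * sandwich u A v.
Proof. by rewrite /sandwich -scalemxAl braketZr. Qed.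

Lemma sandwich1m n (u v : 'cV[C]_n) : sandwich u 1%:M v = braket u v.
Proof. by rewrite /sandwich mul1mx. Qed.

Lemma sandwich_congr m n (B : 'M[C]_(m, n)) A u v :
  sandwich (B *m u) A (B *m v) = sandwich u (B^H *m A *m B) v.
Proof. by rewrite /sandwich braket_mull !mulmxA. Qed.

Lemma conj_sandwich n (u v : 'cV[C]_n) A :
  (sandwich u A v)^* = sandwich v A^H u.
Proof. by rewrite /sandwich conj_braket braket_mull. Qed.

Lemma sandwich_tens n (u v x y : 'cV[C]_n) :
  sandwich u (x *m y^H) v = braket u x * braket y v.
Proof. by rewrite /sandwich -mulmxA braket_mx mul_mx_scalar braketZr mulrC. Qed.

Lemma sandwich_deltaE n (A : 'M[C]_n) i j :
  sandwich (delta_mx i 0) A (delta_mx j 0) = A i j.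
Proof.
rewrite /sandwich /braket -colE mxE (bigD1 i) //= big1 ?addr0 => [|k /negPf ki].
  by rewrite !mxE !eqxx rmorph1 mul1r.
by rewrite !mxE ki rmorph0 mul0r.
Qed.

(** Polarisation: expanding the form at [u + a v] with [a = 1] and [a = 'i] shows that [<u|A|v>]
    equals both [- <v|A|u>] and [<v|A|u>]. *)
Lemma sandwich_eq0 n (A : 'M[C]_n) : (forall v, sandwich v A v = 0) -> A = 0.
Proof.
move=> h; have h2 u v : sandwich u A v = 0.
  have sum0 a : a * sandwich u A v + a^* * sandwich v A u = 0.
    have := h (u + a *: v); rewrite /sandwich mulmxDr -scalemxAr.
    rewrite !(braketDl, braketDr, braketZl, braketZr).
    by rewrite -!/(sandwich _ A _) !h !mulr0 addr0 add0r.
  have h1 := sum0 1; rewrite rmorph1 !mul1r in h1.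
  have := sum0 'i; rewrite conjCi mulNr -mulrBr => /eqP.
  rewrite mulf_eq0 (negPf (neq0Ci C)) /= subr_eq0 => /eqP h3.
  by move/eqP: h1; rewrite -h3 -mulr2n mulrn_eq0 /= => /eqP.
by apply/matrixP=> i j; rewrite mxE -sandwich_deltaE.
Qed.

End Braket.

(** * Positive semi-definite matrices: kernels, rank-one updates, inverses and traces *)

Section Psd.
Context {C : numClosedFieldType}.
Implicit Types (m n : nat).

(** Nonnegative expectation values are real, so the quadratic form of [A^H - A] vanishes. *)
Lemma psd_adjoint n (A : 'M[C]_n) : psd A -> A^H = A.
Proof.
move=> pA; apply/eqP; rewrite -subr_eq0; apply/eqP/sandwich_eq0 => v.
by rewrite sandwichDm sandwichNm -conj_sandwich ge0_conj ?subrr.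
Qed.

Lemma psd_ker n (A : 'M[C]_n) v : psd A -> sandwich v A v = 0 -> A *m v = 0.
Proof.
move=> pA h; have hA := psd_adjoint pA; apply: braket_eq0.
set w := A *m v; set a := braket w w; set c := sandwich w A w.
have a0 : 0 <= a by exact: braket_ge0.
have c1 : 0 < c + 1 by rewrite ltr_wpDl ?pA.
(* The form at [v - t w] is [- 2 t a + t^2 c]. This [t] is the minimiser [a / c] with the
   denominator shifted by 1 to cover [c = 0]; the value is still negative unless [a = 0]. *)
set t := a / (c + 1); have t0 : 0 <= t by rewrite divr_ge0 // ltW.
have := pA (v - t *: w); rewrite /sandwich mulmxBr -scalemxAr -/w.
rewrite !(braketDl, braketDr, braketNl, braketNr, braketZl, braketZr).
rewrite (ge0_conj t0) -/a -/(sandwich w A w) -/c.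
have -> : braket v w = 0 by [].
have -> : braket v (A *m w) = a by rewrite braket_mulr hA.
have -> : 0 - t * a + (- (t * a) - t * - (t * c))
  = - (a ^+ 2 / (c + 1) * ((c + 2) / (c + 1))).
  by rewrite /t; field; rewrite gt_eqF.
have c2 : 0 < (c + 2) / (c + 1) by rewrite divr_gt0 // ltr_wpDl ?pA.
rewrite oppr_ge0 (pmulr_lle0 _ c2) pmulr_lle0 ?invr_gt0 // => le0.
by apply/eqP; rewrite -sqrf_eq0 eq_le le0 exprn_ge0.
Qed.

Lemma psd_congr m n (B : 'M[C]_(m, n)) A : psd A -> psd (B^H *m A *m B).
Proof. by move=> pA v; rewrite -sandwich_congr. Qed.

Lemma psd_congr_adj m n (B : 'M[C]_(m, n)) A : psd A -> psd (B *m A *m B^H).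
Proof. by move=> pA; rewrite -[X in X *m A](adjointK B); apply: psd_congr. Qed.

Lemma psdD n (A B : 'M[C]_n) : psd A -> psd B -> psd (A + B).
Proof. by move=> pA pB v; rewrite sandwichDm addr_ge0. Qed.

Lemma psdZ n a (A : 'M[C]_n) : 0 <= a -> psd A -> psd (a *: A).
Proof. by move=> a0 pA v; rewrite sandwichZm mulr_ge0. Qed.

Lemma psd_id n : psd (1%:M : 'M[C]_n).
Proof. by move=> v; rewrite sandwich1m braket_ge0. Qed.

Lemma psd_tens n (u : 'cV[C]_n) : psd (u *m u^H).
Proof. by move=> v; rewrite sandwich_tens -conj_braket mulrC mul_conjC_ge0. Qed.

(** A Cauchy-Schwarz inequality for the form [A]: positivity is tested at [v - a b q] with
    [b = <q|A|v>]. It allows a small rank-one term to be subtracted as long as its vector lies in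
    the range of [A]. *)
Lemma psd_tensB n (A : 'M[C]_n) q (a : C) : psd A -> 0 <= a ->
  a * sandwich q A q <= 1 -> psd (A - a *: (A *m q *m (A *m q)^H)).
Proof.
move=> pA a0 le1 v; have hA := psd_adjoint pA.
rewrite sandwichDm sandwichNm sandwichZm sandwich_tens.
set b := braket (A *m q) v; have -> : braket v (A *m q) = b^* by rewrite conj_braket.
have b0 : 0 <= b^* * b by rewrite mulrC mul_conjC_ge0.
have := pA (v - (a * b) *: q); rewrite /sandwich mulmxBr -scalemxAr.
rewrite !(braketDl, braketDr, braketNl, braketNr, braketZl, braketZr).
have -> : braket v (A *m q) = b^* by rewrite conj_braket.
have -> : braket q (A *m v) = b by rewrite braket_mulr hA.
have -> : (a * b)^* = a * b^* by rewrite rmorphM /= ge0_conj.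
rewrite -!/(sandwich _ A _) => h.
apply: le_trans h _; rewrite -subr_ge0.
set s := sandwich v A v; set x := sandwich q A q.
have -> : s - a * (b^* * b)
    - (s - a * b * b^* + (- (a * b^* * b) - a * b^* * - (a * b * x)))
  = a * (b^* * b) * (1 - a * x) by ring.
by apply: mulr_ge0; [exact: mulr_ge0 | rewrite subr_ge0].
Qed.

Lemma inv_adjoint n (U Ui : 'M[C]_n) : U^H = U -> U *m Ui = 1%:M -> Ui^H = Ui.
Proof.
move=> hU UUi; rewrite -[LHS]mulmx1 -UUi mulmxA -{1}hU -adjointM.
by rewrite UUi adjoint1 mul1mx.
Qed.

Lemma inv_psd_adjoint n (U Ui : 'M[C]_n) : psd U -> U *m Ui = 1%:M -> Ui^H = Ui.
Proof. by move/psd_adjoint; apply: inv_adjoint. Qed.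

Lemma inv_psd n (U Ui : 'M[C]_n) : psd U -> U *m Ui = 1%:M -> psd Ui.
Proof.
move=> pU UUi; have -> : Ui = Ui^H *m U *m Ui; last exact: psd_congr.
by rewrite (inv_psd_adjoint pU UUi) (mulmx1C UUi) mul1mx.
Qed.

(** By the spectral theorem; the eigenvalues are nonnegative, being expectation values of [A] in its
    eigenvectors. *)
Lemma psd_sqrt n (A : 'M[C]_n) : psd A -> exists B : 'M[C]_n, A = B *m B^H.
Proof.
move=> pA; have hA : A \is hermsymmx.
  by apply/is_hermitianmxP; rewrite expr0 scale1r -[in LHS](psd_adjoint pA).
have /orthomx_spectralP := hermitian_normalmx hA.
set P := spectralmx A; set d := spectral_diag A => AE.
have uP : P \is unitarymx by exact: spectral_unitarymx.
have PE : invmx P = P^H by exact: invmx_unitary.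
have d0 i : 0 <= d 0 i.
  have -> : d 0 i = sandwich (delta_mx i 0) (P *m A *m P^H) (delta_mx i 0).
    rewrite AE -PE !mulmxA mulmxV ?spectral_unit // mul1mx mulmxK ?spectral_unit //.
    by rewrite sandwich_deltaE mxE eqxx mulr1n.
  exact: psd_congr_adj.
exists (P^H *m diag_mx (\row_i sqrtC (d 0 i))).
rewrite adjointM adjointK !mulmxA -(mulmxA P^H) [in LHS]AE PE; congr (_ *m _ *m _).
rewrite /adjoint tr_diag_mx map_diag_mx mulmx_diag; congr diag_mx.
apply/rowP=> i; by rewrite !mxE /= ge0_conj ?sqrtC_ge0 // -expr2 sqrtCK.
Qed.

Lemma mxtrace_congr m n (D : 'M[C]_(m, n)) A :
  \tr (D^H *m A *m D) = \sum_i sandwich (col i D) A (col i D).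
Proof.
by apply: eq_bigr => i _; rewrite -sandwich_deltaE -sandwich_congr -!colE.
Qed.

Lemma mxtrace_psd_ge0 n (A B : 'M[C]_n) : psd A -> psd B -> 0 <= \tr (A *m B).
Proof.
move=> pA /psd_sqrt [D ->]; rewrite mulmxA mxtrace_mulC mulmxA mxtrace_congr.
by apply: sumr_ge0.
Qed.

(** With [B = D D^H] the trace is the sum of [<d|A|d>] over the columns [d] of [D]; if it vanishes,
    every column lies in the kernel of [A]. This turns the trace conditions of a USD measurement
    into products equal to 0. *)
Lemma mxtrace_psd_eq0 n (A B : 'M[C]_n) :
  psd A -> psd B -> \tr (A *m B) = 0 -> A *m B = 0.
Proof.
move=> pA /psd_sqrt [D ->]; rewrite mulmxA mxtrace_mulC mulmxA mxtrace_congr.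
move/eqP; rewrite psumr_eq0 // => /allP h.
suff -> : A *m D = 0 by rewrite mul0mx.
apply/matrixP=> i j; have /eqP/(psd_ker pA) := h j (mem_index_enum _).
by rewrite colE mulmxA -colE => /colP/(_ i); rewrite !mxE.
Qed.

End Psd.
(** * Measurements in adapted frames *)

(* ssreflect's set, unlike generalize, identifies products that differ only in
   the path to the semiring structure. *)
Ltac mx_abel :=
  repeat match goal with
  | |- context [@mulmx ?R ?m ?n ?p ?a ?b] =>
    let x := fresh in set x := (@mulmx R m n p a b); clearbody x
  end; apply/matrixP => ? ?; rewrite !mxE; ring.

(* V, W are orthonormal frames of supp g1 and ker g1; ker g2 is the graph of T,
   with frame A; D is the frame of supp g2 for which (A, W) and (V, D) are dual. *)
Record usd_frame {C : numClosedFieldType} m n (g1 g2 : 'M[C]_n)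
    (V W A D : 'M[C]_(n, m)) (T : 'M[C]_m) : Prop := UsdFrame {
  frAE : A = V + W *m T;
  frDE : D = W - V *m T^H;
  frVV : V^H *m V = 1%:M;
  frWW : W^H *m W = 1%:M;
  frVW : V^H *m W = 0;
  fr_one : V *m V^H + W *m W^H = 1%:M;
  fr_ker1 : g1 *m W = 0;
  fr_ker2 : g2 *m A = 0;
  fr_unitT : T \in unitmx;
  fr_unit1 : V^H *m g1 *m V \in unitmx;
  fr_unit2 : W^H *m g2 *m W \in unitmx }.

Section Frame.
Context {C : numClosedFieldType} {m n : nat} {g1 g2 : 'M[C]_n}.
Context {V W A D : 'M[C]_(n, m)} {T : 'M[C]_m}.
Context (fr : usd_frame g1 g2 V W A D T).
Context (psd1 : psd g1) (psd2 : psd g2).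

Local Notation g := (V^H *m g1 *m V).
Local Notation k := (V^H *m g2 *m V).
Local Notation h := (W^H *m g2 *m W).

Lemma frWV : W^H *m V = 0.
Proof. by rewrite -[LHS]adjointK adjointM adjointK (frVW fr) adjoint0. Qed.

Lemma frVA : V^H *m A = 1%:M.
Proof. by rewrite (frAE fr) mulmxDr mulmxA (frVV fr) (frVW fr) mul0mx addr0. Qed.

Lemma frWA : W^H *m A = T.
Proof. by rewrite (frAE fr) mulmxDr mulmxA frWV (frWW fr) mul1mx add0r. Qed.

Lemma frAV : A^H *m V = 1%:M.
Proof. by rewrite -[LHS]adjointK adjointM adjointK frVA adjoint1. Qed.

Lemma frAW : A^H *m W = T^H.
Proof. by rewrite -[LHS]adjointK adjointM adjointK frWA. Qed.

Lemma frVD : V^H *m D = - T^H.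
Proof. by rewrite (frDE fr) mulmxBr mulmxA (frVV fr) (frVW fr) mul1mx sub0r. Qed.

Lemma frWD : W^H *m D = 1%:M.
Proof. by rewrite (frDE fr) mulmxBr mulmxA (frWW fr) frWV mul0mx subr0. Qed.

Lemma frDW : D^H *m W = 1%:M.
Proof. by rewrite -[LHS]adjointK adjointM adjointK frWD adjoint1. Qed.

Lemma frDV : D^H *m V = - T.
Proof. by rewrite -[LHS]adjointK adjointM adjointK frVD adjointN adjointK. Qed.

Lemma frAD : A^H *m D = 0.
Proof. by rewrite (frDE fr) mulmxBr mulmxA frAV frAW mul1mx subrr. Qed.

(** Expansion in the basis [(A, W)] with coefficients read off by the dual basis [(V, D)]; the terms
    [W T V^H] cancel. *)
Lemma fr_resolution : A *m V^H + W *m D^H = 1%:M.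
Proof.
rewrite -(fr_one fr) (frAE fr) (frDE fr) adjointB adjointM adjointK.
rewrite mulmxDl mulmxBr !mulmxA.
by mx_abel.
Qed.

Lemma fr_resolution_adj : V *m A^H + D *m W^H = 1%:M.
Proof.
by rewrite -adjoint1 -fr_resolution [RHS]adjointD !adjointM !adjointK.
Qed.

Lemma fr_g1E : g1 = V *m g *m V^H.
Proof.
have Wg : W^H *m g1 = 0.
  by rewrite -(psd_adjoint psd1) -adjointM (fr_ker1 fr) adjoint0.
rewrite -[LHS]mulmx1 -[LHS]mul1mx -(fr_one fr).
rewrite mulmxDr !mulmxA (fr_ker1 fr) mul0mx addr0 !mulmxA mulmxDl.
by rewrite -(mulmxA W) Wg mulmx0 addr0.
Qed.

(** Since [g2] kills [A], only the [W] block survives when [g2] is written in the dual bases, and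
    the frame dual to [W] is [D]. *)
Lemma fr_g2E : g2 = D *m h *m D^H.
Proof.
have Ag : A^H *m g2 = 0.
  by rewrite -(psd_adjoint psd2) -adjointM (fr_ker2 fr) adjoint0.
rewrite -[LHS]mulmx1 -[LHS]mul1mx -{1}fr_resolution_adj -fr_resolution.
rewrite mulmxDr !mulmxA (fr_ker2 fr) mul0mx add0r !mulmxA mulmxDl.
by rewrite -(mulmxA V) Ag mulmx0 add0r.
Qed.

Lemma fr_kE : k = T^H *m h *m T.
Proof.
rewrite [g2 in LHS]fr_g2E !mulmxA frVD -!mulmxA frDV.
by rewrite !(mulmxN, mulNmx) opprK.
Qed.


Lemma fr_g1V : g1 *m V = V *m g.
Proof. by rewrite {1}fr_g1E -!mulmxA (frVV fr) mulmx1 !mulmxA. Qed.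

Lemma fr_g2W : g2 *m W = D *m h.
Proof. by rewrite {1}fr_g2E -!mulmxA frDW mulmx1 !mulmxA. Qed.

Lemma fr_supp1E : V = g1 *m V *m invmx g.
Proof. by rewrite fr_g1V mulmxK ?(fr_unit1 fr). Qed.

Lemma fr_supp2E : D = g2 *m W *m invmx h.
Proof. by rewrite fr_g2W mulmxK ?(fr_unit2 fr). Qed.

Section Measurement.
Context {E1 E2 Eq : 'M[C]_n} (E_usd : usd g1 g2 E1 E2 Eq).

(** The columns of [D] lie in the range of [g2], which [E1] annihilates; only the block along [A],
    the dual partner of [V], remains. *)
Lemma usd_E1E : E1 = A *m (V^H *m E1 *m V) *m A^H.
Proof.
have [[p1 _ _] _ _ t2] := E_usd.
have E1D : E1 *m D = 0.
  rewrite fr_supp2E (mulmxA E1) (mulmxA E1).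
  by rewrite (mxtrace_psd_eq0 p1 psd2 t2) !mul0mx.
have DE1 : D^H *m E1 = 0.
  by rewrite -(psd_adjoint p1) -adjointM E1D adjoint0.
rewrite -[LHS]mulmx1 -[LHS]mul1mx -{1}fr_resolution -fr_resolution_adj.
rewrite mulmxDr !mulmxA E1D mul0mx addr0 !mulmxA mulmxDl.
by rewrite -(mulmxA W) DE1 mulmx0 addr0.
Qed.

Lemma usd_E2E : E2 = W *m (W^H *m E2 *m W) *m W^H.
Proof.
have [[_ p2 _] _ t1 _] := E_usd.
have E2V : E2 *m V = 0 by rewrite fr_supp1E !mulmxA (mxtrace_psd_eq0 p2 psd1 t1) !mul0mx.
have VE2 : V^H *m E2 = 0.
  by rewrite -(psd_adjoint p2) -adjointM E2V adjoint0.
rewrite -[LHS]mulmx1 -[LHS]mul1mx -(fr_one fr).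
rewrite mulmxDr !mulmxA E2V mul0mx add0r !mulmxA mulmxDl.
by rewrite -(mulmxA V) VE2 mulmx0 add0r.
Qed.

End Measurement.

Lemma success_frame X Y :
  success g1 g2 (A *m X *m A^H) (W *m Y *m W^H) = \tr (X *m g) + \tr (Y *m h).
Proof.
congr (_ + _).
  rewrite [in LHS]fr_g1E !mulmxA mxtrace_mulC !mulmxA frVA mul1mx.
  by rewrite -(mulmxA X A^H V) frAV mulmx1 -!mulmxA.
rewrite [in LHS]fr_g2E !mulmxA mxtrace_mulC !mulmxA frDW mul1mx.
by rewrite -(mulmxA Y W^H D) frWD mulmx1 -!mulmxA.
Qed.

(** Completing the square with [B = A - W T Ui]: the cross terms of [B U B^H] cancel those of
    [A A^H], and its term [W T Ui T^H W^H] cancels the one in the second block, which leaves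
    [V V^H + W W^H]. *)
Lemma fr_sum1 U Ui : U *m Ui = 1%:M -> U^H = U ->
  A *m (1%:M - U) *m A^H
  + W *m (1%:M + T *m T^H - T *m Ui *m T^H) *m W^H
  + (A - W *m T *m Ui) *m U *m (A - W *m T *m Ui)^H = 1%:M.
Proof.
move=> UUi hU; have UiU := mulmx1C UUi.
have hUi := inv_adjoint hU UUi.
set P := W *m T *m Ui.
have PU : P *m U = W *m T by rewrite -mulmxA UiU mulmx1.
have UP : U *m P^H = T^H *m W^H.
  by rewrite !adjointM hUi !mulmxA UUi mul1mx.
have PTW : P *m T^H *m W^H = W *m T *m Ui *m T^H *m W^H by [].
have -> : (A - P) *m U *m (A - P)^H = A *m U *m A^H - A *m T^H *m W^H
    - W *m T *m A^H + W *m T *m Ui *m T^H *m W^H.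
  rewrite adjointB mulmxBr !mulmxBl -!(mulmxA _ U P^H) UP PU !mulmxA PTW.
  by mx_abel.
have AA : A *m A^H = V *m V^H + A *m T^H *m W^H + W *m T *m A^H
    - W *m T *m T^H *m W^H.
  rewrite (frAE fr) adjointD adjointM !(mulmxDl, mulmxDr) !mulmxA.
  by mx_abel.
rewrite [A *m _]mulmxBr [W *m _]mulmxBr [W *m (_ + _)]mulmxDr !mulmx1.
rewrite !mulmxBl !mulmxDl AA -(fr_one fr) !mulmxA.
by mx_abel.
Qed.

(* Given E1 = A X A^H and U = 1 - X, the form of E_? in the basis (V, D) is
   [[U, -T^H], [-T, 1 + T T^H - Y]], so Y = 1 + T T^H - T U^-1 T^H is the
   largest admissible second block by the Schur complement. *)
Lemma mk_usd U Ui : psd U -> U *m Ui = 1%:M -> psd (1%:M - U) ->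
  psd (1%:M + T *m T^H - T *m Ui *m T^H) ->
  usd g1 g2 (A *m (1%:M - U) *m A^H)
    (W *m (1%:M + T *m T^H - T *m Ui *m T^H) *m W^H)
    ((A - W *m T *m Ui) *m U *m (A - W *m T *m Ui)^H).
Proof.
move=> pU UUi pX pY; split.
- by split; apply: psd_congr_adj.
- exact: fr_sum1 UUi (psd_adjoint pU).
- by rewrite mxtrace_mulC !mulmxA (fr_ker1 fr) !mul0mx mxtrace0.
- by rewrite mxtrace_mulC !mulmxA (fr_ker2 fr) !mul0mx mxtrace0.
Qed.

End Frame.
(** * Duality and first-order conditions *)

(** The limit [b -> 0] in explicit form: if [y < x], a single admissible [b] violates the bound. It
    turns finite variations into first-order conditions. *)
Lemma le_of_le_affine {C : numClosedFieldType} (x y c s : C) :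
  0 <= x -> 0 <= y -> 0 <= c -> 0 <= s ->
  (forall b, 0 < b -> b * s <= 1 -> x <= (1 + b * c) * y) -> x <= y.
Proof.
move=> x0 y0 c0 s0 h; rewrite real_leNgt ?ger0_real //; apply/negP => lt_yx.
have d0 : 0 < x - y by rewrite subr_gt0.
(* [M] exceeds both [d s] and [c y], so [b = d / M] satisfies [b s <= 1] and [b c y < d]. *)
set d := x - y in d0; set M := 1 + c * y + d * s.
have M0 : 0 < M by rewrite ltr_wpDr ?(mulr_ge0 (ltW d0)) // ltr_wpDr ?mulr_ge0.
have bs : d / M * s <= 1.
  rewrite mulrAC ler_pdivrMr // mul1r /M lerDr addr_ge0 ?mulr_ge0 //.
have := h _ (divr_gt0 d0 M0) bs; rewrite -subr_ge0.
have -> : (1 + d / M * c) * y - x = - (d * (1 + d * s) / M).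
  by rewrite /M /d; field; rewrite gt_eqF.
have pos : 0 < d * (1 + d * s) / M.
  by rewrite divr_gt0 // mulr_gt0 // ltr_wpDr // mulr_ge0 // ltW.
by rewrite oppr_ge0 lt_geF.
Qed.

Lemma unitmx_cV {F : fieldType} n (M : 'M[F]_n) :
  (forall v : 'cV_n, M *m v = 0 -> v = 0) -> M \in unitmx.
Proof.
move=> h; rewrite -unitmx_tr -row_free_unit -kermx_eq0; apply/eqP/row_matrixP => i.
have : row i (kermx M^T) *m M^T = 0 by apply/sub_kermxP; rewrite row_sub.
move/(congr1 trmx); rewrite trmx_mul trmxK trmx0 => /h /(congr1 trmx).
by rewrite trmxK trmx0 row0.
Qed.

Lemma mxtrace_tens {C : numClosedFieldType} n (v : 'cV[C]_n) M :
  \tr (v *m v^H *m M) = sandwich v M v.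
Proof.
by rewrite -mulmxA mxtrace_mulC sandwich_mx /mxtrace big_ord1 mxE eqxx mulr1n.
Qed.

(** * The dual certificate and the measurement that it forces *)

Section Duality.
Context {C : numClosedFieldType} {m n : nat} {g1 g2 : 'M[C]_n}.
Context {V W A D : 'M[C]_(n, m)} {T : 'M[C]_m}.
Context (fr : usd_frame g1 g2 V W A D T).
Context (psd1 : psd g1) (psd2 : psd g2).
Context {E1 E2 Eq : 'M[C]_n} (E_opt : optimal_usd g1 g2 E1 E2 Eq).
Local Notation g := (V^H *m g1 *m V).
Local Notation k := (V^H *m g2 *m V).
Local Notation h := (W^H *m g2 *m W).
Local Notation X := (V^H *m E1 *m V).
Local Notation Y := (W^H *m E2 *m W).
Local Notation maxY Ui := (1%:M + T *m T^H - T *m Ui *m T^H).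

Let E_usd : usd g1 g2 E1 E2 Eq := proj1 E_opt.

(** [Q = V Ui T^H + D] is the factor of the dual certificate; [A^H Q] and [W^H Q] are the blocks
    that [E1 = A X A^H] and [E2 = W Y W^H] see. *)
Lemma dual_A Ui : A^H *m (V *m Ui *m T^H + D) = Ui *m T^H.
Proof. by rewrite mulmxDr !mulmxA (frAV fr) mul1mx (frAD fr) addr0. Qed.

Lemma dual_V Ui : V^H *m (V *m Ui *m T^H + D) = Ui *m T^H - T^H.
Proof. by rewrite mulmxDr !mulmxA (frVV fr) mul1mx (frVD fr). Qed.

Lemma dual_W Ui : W^H *m (V *m Ui *m T^H + D) = 1%:M.
Proof. by rewrite mulmxDr !mulmxA (frWV fr) !mul0mx add0r (frWD fr). Qed.

Lemma usd_Eq F1 F2 Fq : usd g1 g2 F1 F2 Fq -> Fq = 1%:M - F1 - F2.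
Proof. by case=> _ <- _ _; rewrite -addrA -opprD addrC addKr. Qed.

Lemma usd_E1_dual F1 F2 Fq Ui : usd g1 g2 F1 F2 Fq ->
  F1 *m (V *m Ui *m T^H + D) = A *m (V^H *m F1 *m V) *m Ui *m T^H.
Proof.
by move=> F; rewrite {1}(usd_E1E fr psd2 F) -(mulmxA _ A^H) dual_A !mulmxA.
Qed.

Lemma usd_E2_dual F1 F2 Fq Ui : usd g1 g2 F1 F2 Fq ->
  F2 *m (V *m Ui *m T^H + D) = W *m (W^H *m F2 *m W).
Proof.
by move=> F; rewrite {1}(usd_E2E fr psd1 F) -(mulmxA _ W^H) dual_W mulmx1.
Qed.

(** The [V] and [W] blocks of [Fq Q]. If both vanish they determine the measurement; if [Ui] inverts
    [1 - X], the first vanishes and the second is the slack of [Y] in the Schur complement bound. *)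
Lemma usd_Eq_dual F1 F2 Fq Ui : usd g1 g2 F1 F2 Fq ->
  let Q := V *m Ui *m T^H + D in
  (V^H *m Fq *m Q = (1%:M - V^H *m F1 *m V) *m Ui *m T^H - T^H) *
  (W^H *m Fq *m Q = 1%:M - T *m (V^H *m F1 *m V) *m Ui *m T^H - W^H *m F2 *m W).
Proof.
move=> F Q; have := usd_E1_dual Ui F; have := usd_E2_dual Ui F.
rewrite (usd_Eq F) -/Q -!(mulmxA _ _ Q).
set X' := V^H *m F1 *m V; set Y' := W^H *m F2 *m W => F2Q F1Q.
rewrite !(mulmxBl, mulmxBr) !mul1mx F1Q F2Q.
rewrite dual_V dual_W !mulmxA (frVA fr) (frWA fr) (frVW fr) (frWW fr).
by rewrite !(mul1mx, mul0mx) subr0; split=> //; mx_abel.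
Qed.

Lemma success_usd F1 F2 Fq : usd g1 g2 F1 F2 Fq ->
  success g1 g2 F1 F2
    = \tr (V^H *m F1 *m V *m g) + \tr (W^H *m F2 *m W *m h).
Proof.
move=> F; rewrite -(success_frame fr psd1 psd2).
by rewrite -(usd_E1E fr psd2 F) -(usd_E2E fr psd1 F).
Qed.

(* Q h Q^H, with Q = V U^-1 T^H + D, is the dual certificate. *)
Lemma success_dual F1 F2 Fq Ui : Ui^H = Ui -> usd g1 g2 F1 F2 Fq ->
  let Q := V *m Ui *m T^H + D in
  success g1 g2 F1 F2 + \tr (V^H *m F1 *m V *m (Ui *m k *m Ui - g))
    + \tr (Fq *m (Q *m h *m Q^H)) = \tr (Q *m h *m Q^H).
Proof.
move=> hUi F Q; set Z := Q *m h *m Q^H.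
rewrite (success_usd F).
(* Because [A^H Q = Ui T^H] and [k = T^H h T], the certificate acts on the first block as [Ui k Ui];
   on the second it acts as [h] because [W^H Q = 1]. *)
have F1Z : \tr (F1 *m Z) = \tr (V^H *m F1 *m V *m (Ui *m k *m Ui)).
  rewrite (fr_kE fr psd2) /Z !mulmxA (usd_E1_dual _ F).
  set X' := V^H *m F1 *m V; rewrite mxtrace_mulC !mulmxA.
  rewrite -[Q^H *m A]adjointK adjointM adjointK dual_A adjointM adjointK hUi.
  by rewrite -!mulmxA mulmxA mxtrace_mulC !mulmxA.
have F2Z : \tr (F2 *m Z) = \tr (W^H *m F2 *m W *m h).
  rewrite /Z !mulmxA (usd_E2_dual _ F) mxtrace_mulC !mulmxA.
  by rewrite -[Q^H *m W]adjointK adjointM adjointK dual_W adjoint1 mul1mx.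
rewrite mulmxBr linearB /= -F1Z -F2Z.
have [_ one _ _] := F; rewrite -[in RHS](mul1mx Z) -one !mulmxDl !linearD /=.
ring.
Qed.

Lemma fr_unit_adjoint : T^H \in unitmx.
Proof. by rewrite /adjoint map_unitmx unitmx_tr (fr_unitT fr). Qed.

(** Complementary slackness. The measurement built from [U] attains the dual value, so both
    nonnegative error terms in [success_dual] vanish for the optimal one; then [Eq Q = 0], and the
    two blocks of this equation give [X] and [Y]. *)
Lemma optimal_of_dual U Ui : psd U -> U *m Ui = 1%:M ->
  psd (1%:M - U) -> psd (maxY Ui) -> psd (Ui *m k *m Ui - g) ->
  (Ui *m k *m Ui - g) *m (1%:M - U) = 0 ->
  X = 1%:M - U /\ Y = maxY Ui.
Proof.
move=> pU UUi pX pY pG GX; have UiU := mulmx1C UUi.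
have hUi := inv_psd_adjoint pU UUi.
have F := mk_usd fr pU UUi pX pY.
set Q := V *m Ui *m T^H + D.
have pZ : psd (Q *m h *m Q^H) by exact/psd_congr_adj/psd_congr.
have XG : (1%:M - U) *m (Ui *m k *m Ui - g) = 0.
  by rewrite -[LHS]adjointK adjointM (psd_adjoint pX) (psd_adjoint pG) GX adjoint0.
have XF : V^H *m (A *m (1%:M - U) *m A^H) *m V = 1%:M - U.
  by rewrite !mulmxA (frVA fr) mul1mx -(mulmxA _ A^H) (frAV fr) mulmx1.
(* The third operator of the candidate is [B U B^H] with [B = A - W T Ui], so its trace against the
   certificate vanishes. *)
have BQ : (A - W *m T *m Ui)^H *m Q = 0.
  rewrite adjointB mulmxBl dual_A !adjointM -!mulmxA dual_W hUi.
  by rewrite mulmx1 subrr.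
have succF := success_dual hUi F; rewrite /= -/Q XF XG mxtrace0 addr0 in succF.
rewrite -!(mulmxA Q) (mulmxA _ Q) -(mulmxA _ _ Q) BQ mulmx0 mul0mx in succF.
rewrite mxtrace0 addr0 in succF.
have succE := success_dual hUi E_usd; rewrite /= -/Q in succE.
have [[pE1 pE2 pEq] _ _ _] := E_usd.
have a0 : 0 <= \tr (X *m (Ui *m k *m Ui - g)).
  by apply: mxtrace_psd_ge0 => //; apply: psd_congr.
have b0 : 0 <= \tr (Eq *m (Q *m h *m Q^H)) by exact: mxtrace_psd_ge0.
have := proj2 E_opt _ _ _ F; rewrite succF mulmxA -succE -addrA gerDl => le0.
have /(mxtrace_psd_eq0 pEq pZ) EqZ : \tr (Eq *m (Q *m h *m Q^H)) = 0.
  by apply/eqP; rewrite eq_le b0 andbT (le_trans _ le0) // lerDr.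
(* As [Q^H W = 1], right multiplication by [W h^-1] strips [h Q^H]. *)
have EqQ : Eq *m Q = 0.
  move: (fr_unit2 fr) EqZ; move: h => H uH /(congr1 (mulmx^~ (W *m invmx H))).
  rewrite mul0mx !mulmxA.
  rewrite -(mulmxA _ Q^H) -[Q^H *m W]adjointK adjointM adjointK dual_W adjoint1.
  by rewrite mulmx1 mulmxK.
have [] := usd_Eq_dual Ui E_usd; rewrite -/Q -!(mulmxA _ Eq) EqQ !mulmx0.
move/esym/eqP; rewrite subr_eq0 => /eqP X1 /esym/eqP Y1.
have {X1} : (1%:M - X) *m Ui = 1%:M.
  by rewrite -[LHS](mulmxK fr_unit_adjoint) X1 mulmxV // fr_unit_adjoint.
move/(congr1 (mulmx^~ U)); rewrite /= -(mulmxA _ Ui U) UiU mulmx1 mul1mx => XU.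
have XE : X = 1%:M - U by rewrite -XU opprB addrC subrK.
split=> //; move: Y1; rewrite XE subr_eq0 => /eqP <-.
rewrite mulmxBr !mulmxBl mulmx1 -(mulmxA T U) UUi mulmx1.
by mx_abel.
Qed.

End Duality.

(** * First-order conditions satisfied by an optimal measurement *)

Section OptimalityConditions.
Context {C : numClosedFieldType} {m n : nat} {g1 g2 : 'M[C]_n}.
Context {V W A D : 'M[C]_(n, m)} {T : 'M[C]_m}.
Context (fr : usd_frame g1 g2 V W A D T).
Context (psd1 : psd g1) (psd2 : psd g2).
Context {E1 E2 Eq : 'M[C]_n} (E_opt : optimal_usd g1 g2 E1 E2 Eq).
Local Notation g := (V^H *m g1 *m V).
Local Notation k := (V^H *m g2 *m V).
Local Notation h := (W^H *m g2 *m W).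
Local Notation X := (V^H *m E1 *m V).
Local Notation Y := (W^H *m E2 *m W).
Local Notation maxY Ui := (1%:M + T *m T^H - T *m Ui *m T^H).

Let E_usd : usd g1 g2 E1 E2 Eq := proj1 E_opt.

Lemma usd_E1V : E1 *m V = A *m X.
Proof. by rewrite {1}(usd_E1E fr psd2 E_usd) -(mulmxA _ A^H) (frAV fr) mulmx1. Qed.

Lemma usd_E2V : E2 *m V = 0.
Proof. by rewrite {1}(usd_E2E fr psd1 E_usd) -(mulmxA _ W^H) (frWV fr) mulmx0. Qed.

Lemma usd_EqV : Eq *m V = V - A *m X.
Proof. by rewrite (usd_Eq E_usd) !mulmxBl mul1mx usd_E1V usd_E2V subr0. Qed.

Lemma usd_psdX : psd X.
Proof. by have [[pE1 _ _] _ _ _] := E_usd; apply: psd_congr. Qed.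

Lemma usd_psdY : psd Y.
Proof. by have [[_ pE2 _] _ _ _] := E_usd; apply: psd_congr. Qed.

Lemma usd_VEqV : V^H *m Eq *m V = 1%:M - X.
Proof. by rewrite -mulmxA usd_EqV mulmxBr !mulmxA (frVV fr) (frVA fr) mul1mx. Qed.

Lemma usd_psdU : psd (1%:M - X).
Proof. by have [[_ _ pEq] _ _ _] := E_usd; rewrite -usd_VEqV; apply: psd_congr. Qed.

(** If [(1 - X) v = 0], then [Eq] has expectation 0 at [V v], hence kills it. The [W] component of
    [Eq V v] is [- T X v], so [X v = 0] and therefore [v = 0]. *)
Lemma usd_unitU : 1%:M - X \in unitmx.
Proof.
apply: unitmx_cV => v Uv; have [[_ _ pEq] _ _ _] := E_usd.
have EqVv : Eq *m (V *m v) = 0.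
  apply: psd_ker => //; rewrite sandwich_congr usd_VEqV /sandwich Uv.
  by rewrite braket0r.
have : W^H *m (Eq *m (V *m v)) = 0 by rewrite EqVv mulmx0.
rewrite !mulmxA -(mulmxA _ Eq) usd_EqV mulmxBr (frWV fr) sub0r (mulmxA W^H) (frWA fr).
rewrite mulNmx -(mulmxA T) => /eqP; rewrite oppr_eq0 => /eqP.
move/(congr1 (mulmx (invmx T))); rewrite mulKmx ?(fr_unitT fr) // mulmx0 => Xv.
by move: Uv; rewrite mulmxBl mul1mx Xv subr0.
Qed.

(** Replacing [Y] by the Schur complement bound gives another measurement, with success larger by
    the trace of the slack against [h]; this trace must be 0, and [h] is invertible. *)
Lemma optimal_maxY Ui : (1%:M - X) *m Ui = 1%:M -> Y = maxY Ui.
Proof.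
move=> UUi; set Q := V *m Ui *m T^H + D.
have hUi := inv_psd_adjoint usd_psdU UUi.
have [VEQ WEQ] := usd_Eq_dual fr psd1 psd2 Ui E_usd.
rewrite -/Q in VEQ WEQ; rewrite UUi mul1mx subrr in VEQ.
have XUi : X *m Ui = Ui - 1%:M.
  by rewrite -UUi mulmxBl mul1mx opprB addrC subrK.
have WEQ' : W^H *m Eq *m Q = maxY Ui - Y.
  rewrite WEQ -(mulmxA T) XUi mulmxBr mulmx1 mulmxBl; by mx_abel.
have pEq : psd Eq by have [[_ _ ?] _ _ _] := E_usd.
have pd : psd (maxY Ui - Y).
  (* [Q] is a combination of [V] and [W] in which [W] has coefficient 1, and [V^H Eq Q = 0], so only
     [W^H Eq Q] contributes. *)
  suff <- : Q^H *m Eq *m Q = maxY Ui - Y by exact: psd_congr.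
  rewrite {1}/Q adjointD (frDE fr) adjointB !adjointM adjointK hUi.
  rewrite !mulmxDl mulNmx -!(mulmxA _ V^H) -!(mulmxA _ _ Q) !mulmxA.
  rewrite mulNmx -!(mulmxA _ V^H) -!(mulmxA _ _ Q) (mulmxA V^H) VEQ.
  by rewrite !mulmx0 add0r oppr0 addr0 mulmxA.
have pY : psd (maxY Ui).
  by rewrite -(subrK Y (maxY Ui)); apply: psdD => //; apply: usd_psdY.
have XE : 1%:M - (1%:M - X) = X by rewrite opprB addrC subrK.
have pX : psd (1%:M - (1%:M - X)) by rewrite XE; apply: usd_psdX.
have := proj2 E_opt _ _ _ (mk_usd fr usd_psdU UUi pX pY).
rewrite XE (success_usd fr psd1 psd2 E_usd) (success_frame fr psd1 psd2).
rewrite lerD2l -subr_le0 -linearB -mulmxBl /= => le0.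
have /mxtrace_psd_eq0 : \tr ((maxY Ui - Y) *m h) = 0.
  by apply/eqP; rewrite eq_le le0 mxtrace_psd_ge0 //; apply: psd_congr.
move=> /(_ pd (psd_congr W psd2)) /(congr1 (mulmx^~ (invmx h))).
rewrite mulmxK ?(fr_unit2 fr) // mul0mx => /eqP; rewrite subr_eq0.
by move/eqP.
Qed.

(* The rank-one update U - a v v^H has inverse U^-1 + b q q^H (Sherman-Morrison);
   the relation between a and b is the one that makes this exact. *)
Lemma optimal_variation Ui v (a b : C) : (1%:M - X) *m Ui = 1%:M ->
  let q := Ui *m v in
  a^* = a -> b = a + a * b * sandwich v Ui v ->
  psd (1%:M - X - a *: (v *m v^H)) -> psd (X + a *: (v *m v^H)) ->
  psd (Y - b *: (T *m q *m (T *m q)^H)) ->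
  a * sandwich v g v <= b * sandwich q k q.
Proof.
move=> UUi q ha bE pU pX pY; have hUi := inv_psd_adjoint usd_psdU UUi.
have Uq : (1%:M - X) *m q = v by rewrite mulmxA UUi mul1mx.
have UUi' : (1%:M - X - a *: (v *m v^H)) *m (Ui + b *: (q *m q^H)) = 1%:M.
  have qH : v^H *m Ui = q^H by rewrite adjointM hUi.
  have Uqq : (1%:M - X) *m (q *m q^H) = v *m q^H by rewrite mulmxA Uq.
  have vUi : v *m v^H *m Ui = v *m q^H by rewrite -mulmxA qH.
  have vvqq : v *m v^H *m (q *m q^H) = sandwich v Ui v *: (v *m q^H).
    rewrite -(mulmxA v) (mulmxA v^H) braket_mx mul_scalar_mx scalemxAr.
    by rewrite -/(sandwich v Ui v).
  rewrite [_ *m (Ui + _)]mulmxDr mulmxBl UUi -scalemxAl vUi.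
  rewrite -scalemxAr mulmxBl -scalemxAl Uqq vvqq; move: (v *m q^H) => M.
  have aE : a = b - a * b * sandwich v Ui v by rewrite {1}bE addrK.
  by apply/matrixP => i j; rewrite !mxE; rewrite {1}aE; ring.
have XE : 1%:M - (1%:M - X - a *: (v *m v^H)) = X + a *: (v *m v^H).
  by rewrite -[_ - X - _]addrA -opprD subKr.
have YE : maxY (Ui + b *: (q *m q^H)) = Y - b *: (T *m q *m (T *m q)^H).
  rewrite (optimal_maxY UUi) mulmxDr mulmxDl -scalemxAr -scalemxAl.
  by rewrite adjointM !mulmxA opprD addrA.
rewrite -XE in pX; rewrite -YE in pY.
have := proj2 E_opt _ _ _ (mk_usd fr pU UUi' pX pY).
rewrite XE YE (success_usd fr psd1 psd2 E_usd) (success_frame fr psd1 psd2).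
rewrite !mulmxDl mulNmx -!scalemxAl !linearD linearN !linearZ /= !mxtrace_tens.
rewrite (sandwich_congr T) -(fr_kE fr psd2) -subr_ge0 => le0.
rewrite -subr_ge0; apply: le_trans le0 _.
rewrite le_eqVlt; apply/orP; left; apply/eqP; ring.
Qed.

(** Move [X] in the direction [+ v v^H]. Both subtracted terms are admissible by [psd_tensB]:
    [v = U q] lies in the range of [U = 1 - X], and [T q] lies in the range of [Y] because [Y] is
    invertible. *)
Lemma optimal_dual_psd Ui : (1%:M - X) *m Ui = 1%:M -> Y \in unitmx ->
  psd (Ui *m k *m Ui - g).
Proof.
move=> UUi uY v; have hUi := inv_psd_adjoint usd_psdU UUi.
have pUi := inv_psd usd_psdU UUi.
rewrite sandwichDm sandwichNm subr_ge0 -[in X in X *m k]hUi -(sandwich_congr Ui).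
set q := Ui *m v; set c := sandwich v Ui v.
set w := invmx Y *m (T *m q); set s := sandwich w Y w.
have c0 : 0 <= c by exact: pUi.
have s0 : 0 <= s by exact: usd_psdY.
have pg : psd g by exact: psd_congr.
have pk : psd k by exact: psd_congr.
apply: (@le_of_le_affine _ _ _ c s) => // b b0 bs.
have bc0 : 0 < 1 + b * c by rewrite ltr_wpDr // mulr_ge0 // ltW.
(* [b] is the free parameter, and [a] solves the Sherman-Morrison relation [b = a + a b c]. *)
set a := b / (1 + b * c); have a0 : 0 < a by rewrite divr_gt0.
have bE : b = a + a * b * c by rewrite /a; field; rewrite gt_eqF.
have Uq : (1%:M - X) *m q = v by rewrite mulmxA UUi mul1mx.
have Yw : Y *m w = T *m q by rewrite mulKVmx.
rewrite -(ler_pM2l a0) mulrA [X in _ <= X * _](_ : _ = b); last first.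
  by rewrite /a; field; rewrite gt_eqF.
apply: (optimal_variation UUi) => //.
- by rewrite ge0_conj // ltW.
- rewrite -Uq; apply: psd_tensB; [exact: usd_psdU | exact: ltW |].
  rewrite /sandwich Uq {1}/q braket_mull hUi -/(sandwich v Ui v) -/c.
  by rewrite /a mulrAC ler_pdivrMr // mul1r lerDr.
- by apply: psdD; [exact: usd_psdX | apply: psdZ (ltW a0) _; exact: psd_tens].
- by rewrite -/q -Yw; apply: psd_tensB; [exact: usd_psdY | exact: ltW |].
Qed.

(** For [X = p v v^H] the opposite move [- t v v^H] is admissible up to [t = p]. It yields the
    reverse inequality at [v], so a positive form vanishes there. *)
Lemma optimal_dual_ker Ui (v : 'cV_m) p : (1%:M - X) *m Ui = 1%:M -> Y \in unitmx ->
  0 < p -> X = p *: (v *m v^H) -> (Ui *m k *m Ui - g) *m v = 0.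
Proof.
move=> UUi uY p0 XE; have hUi := inv_psd_adjoint usd_psdU UUi.
have pUi := inv_psd usd_psdU UUi.
have pG := optimal_dual_psd UUi uY.
apply: psd_ker => //; apply/eqP; rewrite eq_le pG andbT.
rewrite sandwichDm sandwichNm subr_le0 -[in X in X *m k]hUi -(sandwich_congr Ui).
set q := Ui *m v; set c := sandwich v Ui v.
have c0 : 0 <= c by exact: pUi.
have pg : psd g by exact: psd_congr.
have pk : psd k by exact: psd_congr.
have ip0 : 0 <= p^-1 by rewrite invr_ge0 ltW.
apply: (@le_of_le_affine _ _ _ c p^-1) => // t t0 tp.
have tc0 : 0 < 1 + t * c by rewrite ltr_wpDr // mulr_ge0 // ltW.
have tn : 0 <= t by exact: ltW.
have tt : psd (t *: (v *m v^H)) by apply: psdZ tn _; exact: psd_tens.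
have le : - t * sandwich v g v <= - (t / (1 + t * c)) * sandwich q k q.
  apply: (optimal_variation UUi).
  - by rewrite rmorphN /= ge0_conj.
  - by rewrite -/c; field; rewrite gt_eqF.
  - by rewrite scaleNr opprK; apply: psdD => //; exact: usd_psdU.
  - rewrite XE scaleNr -scalerBl; apply: psdZ; last exact: psd_tens.
    by move: tp; rewrite subr_ge0 ler_pdivrMr // mul1r.
  - rewrite scaleNr opprK; apply: psdD; first exact: usd_psdY.
    by apply: psdZ; [rewrite divr_ge0 // ltW | exact: psd_tens].
rewrite !mulNr lerN2 in le; have r0 : 0 < t / (1 + t * c) by rewrite divr_gt0.
rewrite -(ler_pM2l r0); apply: le_trans le _; rewrite mulrA divfK ?gt_eqF //.
Qed.

End OptimalityConditions.
(** * Existence of adapted frames *)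

Lemma orthonormal_row_basis {C : numClosedFieldType} p n k (M : 'M[C]_(p, n)) :
  \rank M = k -> exists S : 'M_(k, n), S *m S^H = 1%:M /\ (S :=: M)%MS.
Proof.
move=> <-; exists (schmidt (row_base M)); split.
  exact/unitarymxP/schmidt_unitarymx/rank_leq_col.
apply: eqmx_trans (eqmx_schmidt_free _) (eq_row_base _); exact: row_base_free.
Qed.

Lemma orthonormal_ker {C : numClosedFieldType} n k (M : 'M[C]_n) :
  n = (\rank M + k)%N -> exists W : 'M_(n, k), W^H *m W = 1%:M /\ M *m W = 0.
Proof.
move=> nE; have rk : \rank (kermx M^H) = k.
  by rewrite mxrank_ker /adjoint mxrank_map mxrank_tr [X in (X - _)%N]nE addKn.
have [S [SS eqS]] := orthonormal_row_basis rk.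
exists S^H; rewrite adjointK; split=> //.
apply: (can_inj (@adjointK _ _ _)); rewrite adjointM adjointK adjoint0.
by apply/sub_kermxP; rewrite eqS.
Qed.

(** The range of a self-adjoint matrix is the orthogonal complement of its kernel. The columns of
    [cokermx A] lie in that kernel and detect membership in the row space. *)
Lemma in_suppP {C : numClosedFieldType} n (A : 'M[C]_n) u : psd A ->
  in_supp A u <-> exists w, u = A *m w.
Proof.
move=> pA; have hA := psd_adjoint pA; split=> [sA | [w -> v Av]]; last first.
  by rewrite braket_mulr hA Av braket0l.
have : (u^H <= A)%MS.
  rewrite submxE; apply/eqP/matrixP => i j; rewrite ord1 [RHS]mxE.
  have : in_ker A (col j (cokermx A)).
    by rewrite /in_ker colE mulmxA mulmx_coker mul0mx.
  move/sA/(congr1 Num.conj); rewrite rmorph0 /= conj_braket /braket colE mulmxA.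
  by rewrite -colE mxE.
by case/submxP => w /(congr1 (@adjoint C _ _)); rewrite adjointK adjointM hA; exists w^H.
Qed.

Section FrameExistence.
Context {C : numClosedFieldType}.

Lemma rank_disjoint n (M N : 'M[C]_n) :
  (forall w : 'rV_n, (w <= M)%MS -> (w <= N)%MS -> w = 0) ->
  (\rank M + \rank N <= n)%N.
Proof.
move=> h; rewrite -mxrank_disjoint_sum ?rank_leq_col //.
by apply/eqP/rowV0P => w; rewrite sub_capmx => /andP[]; apply: h.
Qed.

(** Each trivial intersection bounds a sum of two dimensions by [n]. The mixed pairs give equal
    ranks; the supports and the kernels give [n] as their sum. *)
Lemma rank_of_general_position n (g1 g2 : 'M[C]_n) : psd g1 -> psd g2 ->
  trivial_meet (in_supp g1) (in_supp g2) ->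
  trivial_meet (in_ker g1) (in_ker g2) ->
  trivial_meet (in_supp g1) (in_ker g2) ->
  trivial_meet (in_ker g1) (in_supp g2) ->
  n = (\rank g1).*2 /\ \rank g2 = \rank g1.
Proof.
move=> p1 p2 ss kk sk ks.
have suppw (g : 'M[C]_n) (w : 'rV_n) : psd g -> (w <= g)%MS -> in_supp g w^H.
  move=> pg /submxP [a ->]; apply/(in_suppP _ pg); exists a^H.
  by rewrite adjointM (psd_adjoint pg).
have kerw (g : 'M[C]_n) (w : 'rV_n) : psd g -> (w <= kermx g)%MS -> in_ker g w^H.
  move=> pg /sub_kermxP wg; rewrite /in_ker -[g](psd_adjoint pg) -adjointM wg.
  exact: adjoint0.
have w0 (w : 'rV[C]_n) : w^H = 0 -> w = 0.
  by move=> w0; rewrite -[w]adjointK w0 adjoint0.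
have a1 := rank_disjoint (fun w h1 h2 => w0 _ (ss _ (suppw _ _ p1 h1) (suppw _ _ p2 h2))).
have a2 := rank_disjoint (fun w h1 h2 => w0 _ (kk _ (kerw _ _ p1 h1) (kerw _ _ p2 h2))).
have a3 := rank_disjoint (fun w h1 h2 => w0 _ (sk _ (suppw _ _ p1 h1) (kerw _ _ p2 h2))).
have a4 := rank_disjoint (fun w h1 h2 => w0 _ (ks _ (kerw _ _ p1 h1) (suppw _ _ p2 h2))).
move: a2 a3 a4; rewrite !mxrank_ker.
have := rank_leq_row g1; have := rank_leq_row g2.
move: (\rank g1) (\rank g2) a1 => a b; lia.
Qed.

Context {m : nat} {g1 g2 : 'M[C]_(m + m)} {V : 'M[C]_(m + m, m)}.
Context (psd1 : psd g1) (psd2 : psd g2).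
Context (ker_ker : trivial_meet (in_ker g1) (in_ker g2)).
Context (supp_ker : trivial_meet (in_supp g1) (in_ker g2)).

Lemma usd_frame_exists : \rank g1 = m -> \rank g2 = m ->
  V^H *m V = 1%:M -> (forall v, in_supp g1 (V *m v)) ->
  exists W A D T, usd_frame g1 g2 V W A D T.
Proof.
move=> r1 r2 VV Vsupp.
have [W [WW gW]] : exists W : 'M_(m + m, m), W^H *m W = 1%:M /\ g1 *m W = 0.
  by apply: orthonormal_ker; rewrite r1.
have [N [NN gN]] : exists W : 'M_(m + m, m), W^H *m W = 1%:M /\ g2 *m W = 0.
  by apply: orthonormal_ker; rewrite r2.
have VW : V^H *m W = 0.
  apply/matrixP => i j; rewrite [RHS]mxE -sandwich_deltaE /sandwich -mulmxA.
  rewrite braket_mulr adjointK -conj_braket Vsupp ?rmorph0 //.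
  by rewrite /in_ker mulmxA gW mul0mx.
have WV : W^H *m V = 0 by rewrite -[LHS]adjointK adjointM adjointK VW adjoint0.
have one : V *m V^H + W *m W^H = 1%:M.
  rewrite -mul_row_col; apply: mulmx1C.
  by rewrite mul_col_row VV WW VW WV -scalar_mx_block.
have injl (P : 'M[C]_(m + m, m)) (v : 'cV_m) : P^H *m P = 1%:M -> P *m v = 0 -> v = 0.
  by move=> PP Pv; rewrite -[v]mul1mx -PP -mulmxA Pv mulmx0.
(* A vector of [ker g2] with no [V] component lies in [ker g1], hence is 0. *)
have uVN : V^H *m N \in unitmx.
  apply: unitmx_cV => v VNv; apply: (injl _ _ NN); apply: ker_ker.
    rewrite /in_ker -(mul1mx (N *m v)) -one mulmxDl -!mulmxA (mulmxA V^H) VNv.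
    by rewrite mulmx0 add0r mulmxA gW mul0mx.
  by rewrite /in_ker mulmxA gN mul0mx.
(* Normalising to [V^H A = 1] presents [ker g2] as the graph over [supp g1] of [T = W^H A]. *)
set A := N *m invmx (V^H *m N).
have VA : V^H *m A = 1%:M by rewrite mulmxA mulmxV.
have {uVN} gA : g2 *m A = 0 by rewrite mulmxA gN mul0mx.
move: A VA gA => A VA gA.
exists W, A, (W - V *m (W^H *m A)^H), (W^H *m A); split=> //.
- by rewrite -[LHS]mul1mx -one mulmxDl -!mulmxA VA mulmx1.
(* If [T v = 0], then [A v = V v] lies in [supp g1] and in [ker g2]. *)
- apply: unitmx_cV => v Tv; apply: (injl _ _ VV); apply: supp_ker => //.
  have -> : V *m v = A *m v; last by rewrite /in_ker mulmxA gA mul0mx.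
  rewrite -[A]mul1mx -one !mulmxDl -!mulmxA (mulmxA V^H) VA.
  by rewrite mul1mx (mulmxA W^H) Tv mulmx0 addr0.
- apply: unitmx_cV => v gv; apply: (injl _ _ VV); apply: braket_eq0.
  apply: (Vsupp v); apply: psd_ker => //.
  by rewrite sandwich_congr /sandwich gv braket0r.
- apply: unitmx_cV => v hv; apply: (injl _ _ WW); apply: ker_ker.
    by rewrite /in_ker mulmxA gW mul0mx.
  by apply: psd_ker => //; rewrite sandwich_congr /sandwich hv braket0r.
Qed.

End FrameExistence.
(** * The rank-one case *)

(** For [u < 1] a factor [1 - u] can be divided out; otherwise the left side fails because the
    second summand is nonnegative. *)
Lemma criterion_scalar {C : numClosedFieldType} (u t : C) : 0 < u -> 0 <= t ->
  (u + (1 - u) ^+ 2 / u * t < 1) = (u < 1) && ((u^-1 - 1) * t < 1).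
Proof.
move=> u0 t0; have un : u != 0 by rewrite gt_eqF.
have [u1 | u1] /= := boolP (u < 1).
  have d0 : 0 < 1 - u by rewrite subr_gt0.
  have -> : (1 - u) ^+ 2 / u * t = (1 - u) * ((u^-1 - 1) * t) by field.
  by rewrite addrC -ltrBrDr -[X in _ < X]mulr1 ltr_pM2l.
apply/negbTE; apply: contra u1; apply: le_lt_trans; rewrite lerDl.
(* Squares in [C] are nonnegative only for real arguments. *)
have ur : u - 1 \is Num.real by rewrite realB ?ger0_real // ltW.
apply: mulr_ge0 => //; apply: divr_ge0; last exact: ltW.
by rewrite -sqrrN opprB real_exprn_even_ge0.
Qed.

Section Plane.
Context {C : numClosedFieldType} {m n : nat} {g1 g2 : 'M[C]_n}.
Context {V W A D : 'M[C]_(n, m)} {T : 'M[C]_m}.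
Context (fr : usd_frame g1 g2 V W A D T).
Context {e1 e2 : 'cV[C]_m}.
Context (e22 : braket e2 e2 = 1) (e12 : braket e1 e2 = 0).
Context {u : C} (u0 : 0 < u).
Local Notation g := (V^H *m g1 *m V).
Local Notation k := (V^H *m g2 *m V).
Local Notation maxY Ui := (1%:M + T *m T^H - T *m Ui *m T^H).
Local Notation P := (e2 *m e2^H).
Local Notation U := (1%:M - (1 - u) *: P).
Local Notation Ui := (1%:M + (u^-1 - 1) *: P).

Let un : u != 0. Proof. by rewrite gt_eqF. Qed.

Lemma plane_proj : P *m P = P.
Proof. by rewrite -mulmxA (mulmxA e2^H) braket_mx e22 mul1mx. Qed.

Lemma plane_proj1 : P *m e1 = 0.
Proof.
by rewrite -mulmxA braket_mx -conj_braket e12 rmorph0 mul_mx_scalar scale0r.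
Qed.

Lemma plane_proj2 : P *m e2 = e2.
Proof. by rewrite -mulmxA braket_mx e22 mulmx1. Qed.

Lemma plane_inv : U *m Ui = 1%:M.
Proof.
rewrite mulmxBl mul1mx mulmxDr mulmx1 -scalemxAl -scalemxAr plane_proj.
move: P => M; apply/matrixP => i j; rewrite !mxE.
by field.
Qed.

Lemma plane_Ui1 : Ui *m e1 = e1.
Proof. by rewrite mulmxDl mul1mx -scalemxAl plane_proj1 scaler0 addr0. Qed.

Lemma plane_Ui2 : Ui *m e2 = u^-1 *: e2.
Proof.
rewrite mulmxDl mul1mx -scalemxAl plane_proj2 -[X in X + _]scale1r -scalerDl.
by rewrite addrC subrK.
Qed.

Lemma plane_maxY : maxY Ui = 1%:M - (u^-1 - 1) *: (T *m e2 *m (T *m e2)^H).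
Proof.
rewrite mulmxDr mulmx1 mulmxDl -scalemxAr -scalemxAl adjointM !mulmxA.
by rewrite opprD addrA addrK.
Qed.

Lemma plane_psdU : u <= 1 -> psd U.
Proof.
move=> u1; rewrite -[e2]mul1mx; apply: psd_tensB; first exact: psd_id.
  by rewrite subr_ge0.
by rewrite sandwich1m e22 mulr1 gerBl ltW.
Qed.

Lemma plane_UiH : Ui^H = Ui.
Proof.
have ui0 : 0 <= u^-1 by rewrite invr_ge0 ltW.
rewrite adjointD adjoint1 adjointZ adjointM adjointK rmorphB /= conjC1.
by rewrite ge0_conj.
Qed.

(** [Ui] acts on [e1] and [e2] by the factors 1 and [u^-1], so the matrix entries of [Ui k Ui - g]
    become the differences in the criterion. *)
Lemma plane_dual x y : sandwich x (Ui *m k *m Ui - g) y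
  = sandwich (V *m (Ui *m x)) g2 (V *m (Ui *m y)) - sandwich (V *m x) g1 (V *m y).
Proof.
rewrite sandwichDm sandwichNm -{1}plane_UiH -(sandwich_congr Ui).
by rewrite -!(sandwich_congr V).
Qed.

Lemma plane_dual11 : sandwich e1 (Ui *m k *m Ui - g) e1
  = sandwich (V *m e1) g2 (V *m e1) - sandwich (V *m e1) g1 (V *m e1).
Proof. by rewrite plane_dual plane_Ui1. Qed.

Lemma plane_dual21 : sandwich e2 (Ui *m k *m Ui - g) e1
  = u^-1 * sandwich (V *m e2) g2 (V *m e1) - sandwich (V *m e2) g1 (V *m e1).
Proof.
have ui0 : 0 <= u^-1 by rewrite invr_ge0 ltW.
rewrite plane_dual plane_Ui1 plane_Ui2 /sandwich -scalemxAr braketZl.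
by rewrite ge0_conj.
Qed.

Lemma plane_dual22 : sandwich e2 (Ui *m k *m Ui - g) e2
  = u^-1 ^+ 2 * sandwich (V *m e2) g2 (V *m e2) - sandwich (V *m e2) g1 (V *m e2).
Proof.
have ui0 : 0 <= u^-1 by rewrite invr_ge0 ltW.
rewrite plane_dual plane_Ui2 /sandwich -scalemxAr -scalemxAr braketZl braketZr.
by rewrite ge0_conj // mulrA expr2.
Qed.

(** [K V e2 = s V e2 + (s - s^-1) W T e2] with [s^2 = u]. This is checked after multiplication by
    [g1 + g2], using [g1 W = 0] and [g2 W T = - g2 V]; the two summands are orthogonal. *)
Lemma plane_K : ratio_r g1 g2 (V *m e2) = u -> g1 + g2 \in unitmx ->
  let K := opK g1 g2 (V *m e2) in
  sandwich (V *m e2) (K^H *m K) (V *m e2)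
    = u + (1 - u) ^+ 2 / u * braket (T *m e2) (T *m e2).
Proof.
move=> ru ug K; set s := sqrtC u.
have s0 : 0 < s by rewrite sqrtC_gt0.
have us : u = s ^+ 2 by rewrite sqrtCK.
have is0 : 0 <= s^-1 by rewrite invr_ge0 ltW.
have Ke : K *m (V *m e2) = s *: (V *m e2) + (s - s^-1) *: (W *m (T *m e2)).
  rewrite /K /opK ru -/s -mulmxA; apply: (can_inj (mulKmx ug)); rewrite mulKVmx //.
  have g1W : g1 *m (W *m (T *m e2)) = 0 by rewrite mulmxA (fr_ker1 fr) mul0mx.
  have g2W : g2 *m (W *m (T *m e2)) = - (g2 *m (V *m e2)).
    apply/eqP; rewrite -addr_eq0 -mulmxDr !mulmxA addrC -mulmxDl -(frAE fr).
    by rewrite mulmxA (fr_ker2 fr) mul0mx.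
  rewrite mulmxDl -!scalemxAl mulmxDr -!scalemxAr !mulmxDl g1W g2W add0r.
  move: (g1 *m _) (g2 *m _) => a b; apply/matrixP=> i j; rewrite !mxE; ring.
rewrite -[K^H]mulmx1 -sandwich_congr sandwich1m Ke.
rewrite !(braketDl, braketDr, braketZl, braketZr) !braket_mull.
rewrite !(mulmxA V^H) !(mulmxA W^H).
rewrite (frVV fr) (frWW fr) (frVW fr) (frWV fr) !mul1mx !mul0mx ?mulmx0 !braket0r e22.
rewrite rmorphB /= !ge0_conj ?(ltW s0) // us.
by field; rewrite gt_eqF.
Qed.

End Plane.

(** * Optimality when the first block is [(1 - u) |e2><e2|] *)

Section PlaneOptimality.
Context {C : numClosedFieldType} {m n : nat} {g1 g2 : 'M[C]_n}.
Context {V W A D : 'M[C]_(n, m)} {T : 'M[C]_m}.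
Context (fr : usd_frame g1 g2 V W A D T).
Context (psd1 : psd g1) (psd2 : psd g2).
Context {e1 e2 : 'cV[C]_m}.
Context (e22 : braket e2 e2 = 1) (e12 : braket e1 e2 = 0).
Context (e_res : e1 *m e1^H + e2 *m e2^H = 1%:M).
Context {u : C} (u0 : 0 < u).
Context {E1 E2 Eq : 'M[C]_n} (E_opt : optimal_usd g1 g2 E1 E2 Eq).
Local Notation g := (V^H *m g1 *m V).
Local Notation k := (V^H *m g2 *m V).
Local Notation X := (V^H *m E1 *m V).
Local Notation Y := (W^H *m E2 *m W).
Local Notation maxY Ui := (1%:M + T *m T^H - T *m Ui *m T^H).
Local Notation P := (e2 *m e2^H).
Local Notation U := (1%:M - (1 - u) *: P).
Local Notation Ui := (1%:M + (u^-1 - 1) *: P).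
Local Notation t := (braket (T *m e2) (T *m e2)).

Lemma plane_Te_gt0 : 0 < t.
Proof.
apply: braket_gt0; apply/eqP => Te.
have e20 : e2 = 0 by rewrite -[e2](mulKmx (fr_unitT fr)) Te mulmx0.
by move: e22; rewrite e20 braket0l => /eqP; rewrite eq_sym oner_eq0.
Qed.

Lemma rank_usd_E1 : \rank E1 = \rank X.
Proof.
apply/eqP; rewrite eqn_leq; apply/andP; split; last first.
  by apply: leq_trans (mxrankM_maxl _ _) _; apply: mxrankM_maxr.
rewrite {1}(usd_E1E fr psd2 (proj1 E_opt)).
by apply: leq_trans (mxrankM_maxl _ _) _; apply: mxrankM_maxr.
Qed.

Lemma rank_usd_E2 : \rank E2 = \rank Y.
Proof.
apply/eqP; rewrite eqn_leq; apply/andP; split; last first.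
  by apply: leq_trans (mxrankM_maxl _ _) _; apply: mxrankM_maxr.
rewrite {1}(usd_E2E fr psd1 (proj1 E_opt)).
by apply: leq_trans (mxrankM_maxl _ _) _; apply: mxrankM_maxr.
Qed.

(** The dual matrix is positive and kills [e2], which gives the first three claims entry by entry.
    The last one is positivity of [Y] at [T e2], where its value is [t (1 - (u^-1 - 1) t)]. *)
Lemma plane_forward : X = (1 - u) *: P -> u < 1 -> Y \in unitmx ->
  [/\ 0 <= sandwich (V *m e1) (g2 - g1) (V *m e1),
      sandwich (V *m e2) g2 (V *m e1) = u * sandwich (V *m e2) g1 (V *m e1),
      sandwich (V *m e2) g2 (V *m e2) = u ^+ 2 * sandwich (V *m e2) g1 (V *m e2)
    & (u^-1 - 1) * t < 1].
Proof.
move=> XE u1 uY; have un : u != 0 by rewrite gt_eqF.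
have UUi : (1%:M - X) *m Ui = 1%:M by rewrite XE (plane_inv e22 u0).
have pG := optimal_dual_psd fr psd1 psd2 E_opt UUi uY.
have Ge2 : (Ui *m k *m Ui - g) *m e2 = 0.
  by apply: (optimal_dual_ker fr psd1 psd2 E_opt UUi uY _ XE); rewrite subr_gt0.
have e2G : sandwich e2 (Ui *m k *m Ui - g) e1 = 0.
  by rewrite -[LHS]conjCK conj_sandwich (psd_adjoint pG) /sandwich Ge2 braket0r rmorph0.
have := pG e1; rewrite (plane_dual11 e12 u0) => G11.
split.
- by rewrite sandwichDm sandwichNm.
- move/eqP: e2G; rewrite (plane_dual21 e22 e12 u0) subr_eq0 => /eqP <-.
  by rewrite mulVKf.
- have /eqP : sandwich e2 (Ui *m k *m Ui - g) e2 = 0.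
    by rewrite /sandwich Ge2 braket0r.
  rewrite (plane_dual22 e22 u0) subr_eq0 => /eqP <-.
  by rewrite exprVn mulVKf // expf_neq0.
have t0 := plane_Te_gt0.
have YE := optimal_maxY fr psd1 psd2 E_opt UUi.
have : 0 < sandwich (T *m e2) Y (T *m e2).
  rewrite lt0r (usd_psdY E_opt) andbT; apply/eqP => /(psd_ker (usd_psdY E_opt)) YT.
  have Te : T *m e2 = 0 by rewrite -[T *m e2](mulKmx uY) YT mulmx0.
  by move: t0; rewrite Te braket0l ltxx.
rewrite YE plane_maxY sandwichDm sandwichNm sandwichZm sandwich_tens sandwich1m.
by rewrite subr_gt0 mulrA gtr_pMl.
Qed.

(** The equalities reduce the dual matrix [G] to a nonnegative multiple of [|e1><e1|], so [G] is
    positive and kills [X]; duality then identifies the optimal measurement. *)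
Lemma plane_backward :
  0 <= sandwich (V *m e1) (g2 - g1) (V *m e1) ->
  sandwich (V *m e2) g2 (V *m e1) = u * sandwich (V *m e2) g1 (V *m e1) ->
  sandwich (V *m e2) g2 (V *m e2) = u ^+ 2 * sandwich (V *m e2) g1 (V *m e2) ->
  u < 1 -> (u^-1 - 1) * t < 1 -> \rank E1 = 1%N /\ \rank E2 = m.
Proof.
move=> G11 k21 k22 u1 ut1; have un : u != 0 by rewrite gt_eqF.
have e2n : e2 != 0.
  by apply/eqP => e20; move: e22; rewrite e20 braket0l => /eqP; rewrite eq_sym oner_eq0.
have iu : 0 <= u^-1 - 1 by rewrite subr_ge0 invf_ge1 // ltW.
have UUi : U *m Ui = 1%:M by exact: plane_inv.
have pU : psd U by apply: plane_psdU => //; exact: ltW.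
have XE : 1%:M - U = (1 - u) *: P by rewrite subKr.
have pX : psd (1%:M - U).
  by rewrite XE; apply: psdZ; [rewrite subr_ge0 ltW | exact: psd_tens].
have pY : psd (maxY Ui).
  rewrite plane_maxY -[T *m e2]mul1mx; apply: psd_tensB => //; first exact: psd_id.
  by rewrite sandwich1m ltW.
set G := Ui *m k *m Ui - g.
have hG : G^H = G.
  rewrite adjointB !adjointM !adjointK (psd_adjoint psd1) (psd_adjoint psd2).
  by rewrite (plane_UiH u0) /G !mulmxA.
have Ge21 : sandwich e2 G e1 = 0.
  by rewrite (plane_dual21 e22 e12 u0) k21 mulKf // subrr.
have Ge22 : sandwich e2 G e2 = 0.
  by rewrite (plane_dual22 e22 u0) k22 exprVn mulKf ?subrr // expf_neq0.
have Ge12 : sandwich e1 G e2 = 0 by rewrite -hG -conj_sandwich Ge21 rmorph0.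
have Ge2 : G *m e2 = 0.
  rewrite -[LHS]mul1mx -e_res mulmxDl -!mulmxA !(mulmxA _ G) !sandwich_mx.
  by rewrite !mul_mx_scalar Ge12 Ge22 !scale0r addr0.
have GE : G = sandwich e1 G e1 *: (e1 *m e1^H).
  rewrite -[LHS]mulmx1 -e_res mulmxDr !mulmxA Ge2 mul0mx addr0.
  rewrite -[G *m e1]mul1mx -e_res mulmxDl -!(mulmxA _ _ (G *m e1)) !(mulmxA _ G).
  by rewrite !sandwich_mx !mul_mx_scalar Ge21 scale0r addr0 -scalemxAl.
have pG : psd G.
  rewrite GE; apply: psdZ; last exact: psd_tens.
  by rewrite (plane_dual11 e12 u0) -sandwichNm -sandwichDm.
have GX : G *m (1%:M - U) = 0 by rewrite XE -scalemxAr mulmxA Ge2 mul0mx scaler0.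
have [EX EY] := optimal_of_dual fr psd1 psd2 E_opt pU UUi pX pY pG GX.
rewrite rank_usd_E1 rank_usd_E2 EX EY XE; split.
  apply/eqP; rewrite eqn_leq lt0n mxrank_eq0; apply/andP; split.
    rewrite -mul_scalar_mx mulmxA.
    by apply: leq_trans (mxrankM_maxr _ _) (rank_leq_row _).
  rewrite scaler_eq0 subr_eq0 gt_eqF //=; apply/eqP => P0.
  by move/eqP: e2n; rewrite -(plane_proj2 e22) P0 mul0mx.
(* A kernel vector of [Y] is a multiple of [w = T e2], but [w] has the nonzero eigenvalue
   [1 - (u^-1 - 1) <w|w>]. *)
apply: mxrank_unit; apply: unitmx_cV => z; rewrite plane_maxY => Yz.
set w := T *m e2 in Yz ut1.
have zE : z = ((u^-1 - 1) * braket w z) *: w.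
  move/eqP: Yz; rewrite mulmxBl mul1mx subr_eq0 => /eqP {1}->.
  by rewrite -scalemxAl -mulmxA braket_mx mul_mx_scalar scalerA.
have /eqP : (1 - (u^-1 - 1) * braket w w) * braket w z = 0.
  have wzE : braket w z = (u^-1 - 1) * braket w z * braket w w.
    by rewrite {1}zE braketZr.
  by rewrite mulrBl mul1r {1}wzE; ring.
rewrite mulf_eq0 subr_eq0 eq_sym lt_eqF //= => /eqP wz.
by rewrite zE wz mulr0 scale0r.
Qed.

End PlaneOptimality.

(** * The criterion in dimension four *)

Section Criterion.
Context {C : numClosedFieldType} {g1 g2 : 'M[C]_(2 + 2)}.
Context (psd1 : psd g1) (psd2 : psd g2).
Context (supp_supp : trivial_meet (in_supp g1) (in_supp g2)).
Context (ker_ker : trivial_meet (in_ker g1) (in_ker g2)).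
Context (supp_ker : trivial_meet (in_supp g1) (in_ker g2)).
Context (ker_supp : trivial_meet (in_ker g1) (in_supp g2)).

Lemma general_position_rank : \rank g1 = 2%N /\ \rank g2 = 2%N.
Proof.
have [] := rank_of_general_position psd1 psd2 supp_supp ker_ker supp_ker ker_supp.
by move=> r1 ->; lia.
Qed.

Lemma general_position_unit : g1 + g2 \in unitmx.
Proof.
apply: unitmx_cV => v /(congr1 (braket v)); rewrite braket0r -/(sandwich v _ v).
rewrite sandwichDm => /eqP; rewrite paddr_eq0 ?psd1 ?psd2 // => /andP[/eqP v1 /eqP v2].
by apply: ker_ker; apply: psd_ker.
Qed.

Lemma general_position_gt0 v : in_supp g1 v -> v != 0 ->
  0 < sandwich v g1 v /\ 0 < sandwich v g2 v.
Proof.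
move=> sv v0; rewrite !lt0r psd1 psd2 !andbT; split; apply: contra v0 => /eqP.
  by move/(psd_ker psd1)/sv/braket_eq0->.
by move/(psd_ker psd2)/(supp_ker sv)->.
Qed.

Context {E1 E2 Eq : 'M[C]_(2 + 2)} (E_opt : optimal_usd g1 g2 E1 E2 Eq).

(** The given basis is itself the frame [V], and [u] is taken to be [r], which makes the condition
    on [<phip|g2|phip>] automatic. *)
Lemma criterion_sufficient (phi phip : 'cV[C]_(2 + 2)) :
  onb2_of (in_supp g1) phi phip ->
  0 <= sandwich phi (g2 - g1) phi ->
  sqrtC (sandwich phip g1 phip) * sandwich phip g2 phi
    = sqrtC (sandwich phip g2 phip) * sandwich phip g1 phi ->
  sandwich phip ((opK g1 g2 phip)^H *m opK g1 g2 phip) phip < 1 ->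
  \rank E1 = 1%N /\ \rank E2 = 2%N.
Proof.
move=> [[s1 s2] [b11 b22 b12] _] G11 G21 K1.
have [r1 r2] := general_position_rank.
have b21 : braket phip phi = 0 by rewrite -conj_braket b12 rmorph0.
pose V : 'M[C]_(2 + 2, 1 + 1) := row_mx phi phip.
pose e1 : 'cV[C]_(1 + 1) := col_mx 1%:M 0.
pose e2 : 'cV[C]_(1 + 1) := col_mx 0 1%:M.
have Ve1 : V *m e1 = phi by rewrite mul_row_col mulmx1 mulmx0 addr0.
have Ve2 : V *m e2 = phip by rewrite mul_row_col mulmx1 mulmx0 add0r.
have VV : V^H *m V = 1%:M.
  rewrite adjoint_row_mx mul_col_row !braket_mx b11 b22 b12 b21.
  have -> : 0%:M = 0 :> 'M[C]_1 by exact: raddf0.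
  by rewrite -scalar_mx_block.
have e1H : e1^H = row_mx 1%:M 0.
  by rewrite /adjoint tr_col_mx map_row_mx trmx1 trmx0 map_mx1 map_mx0.
have e2H : e2^H = row_mx 0 1%:M.
  by rewrite /adjoint tr_col_mx map_row_mx trmx1 trmx0 map_mx1 map_mx0.
have e_res : e1 *m e1^H + e2 *m e2^H = 1%:M.
  rewrite e1H e2H !mul_col_row !mulmx0 !mul0mx !mulmx1 add_block_mx.
  by rewrite !addr0 !add0r -scalar_mx_block.
have ebr (x y : 'cV[C]_(1 + 1)) : braket x y = braket (V *m x) (V *m y).
  by rewrite braket_mull mulmxA VV mul1mx.
have e11 : braket e1 e1 = 1 by rewrite ebr Ve1.
have e22 : braket e2 e2 = 1 by rewrite ebr Ve2.
have e12 : braket e1 e2 = 0 by rewrite ebr Ve1 Ve2.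
have Vsupp (x : 'cV_2) : in_supp g1 (V *m x).
  have -> : V *m x = braket e1 x *: phi + braket e2 x *: phip.
    rewrite -[x in LHS]mul1mx -e_res mulmxDl mulmxDr -!mulmxA !braket_mx.
    by rewrite !mulmxA Ve1 Ve2 !mul_mx_scalar.
  by move=> v vk; rewrite braketDr !braketZr s1 // s2 // !mulr0 addr0.
have [W [A [D [T fr]]]] := usd_frame_exists psd1 psd2 ker_ker supp_ker r1 r2 VV Vsupp.
have p0 : phip != 0.
  by apply/eqP => p0; move/eqP: b22; rewrite p0 braket0l eq_sym oner_eq0.
have [g22 k22] := general_position_gt0 s2 p0.
set u := ratio_r g1 g2 phip.
have u2 : u ^+ 2 = sandwich phip g2 phip / sandwich phip g1 phip by rewrite sqrtCK.
have u0 : 0 < u by rewrite sqrtC_gt0 divr_gt0.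
have K22 : sandwich phip g2 phip = u ^+ 2 * sandwich phip g1 phip.
  by rewrite u2 divfK ?gt_eqF.
(* Dividing the square-root condition by its first factor leaves
   [<phip|g2|phi> = u <phip|g1|phi>]. *)
have su : sqrtC (sandwich phip g2 phip) = u * sqrtC (sandwich phip g1 phip).
  by rewrite K22 sqrtCM ?nnegrE ?exprn_ge0 ?ltW // exprCK // ltW.
have K21 : sandwich phip g2 phi = u * sandwich phip g1 phi.
  have sn : sqrtC (sandwich phip g1 phip) != 0 by rewrite sqrtC_eq0 gt_eqF.
  by apply: (mulfI sn); rewrite G21 su; ring.
have := plane_K fr e22 u0; rewrite Ve2 => /(_ erefl general_position_unit) KE.
move: K1; rewrite KE criterion_scalar ?braket_ge0 // => /andP[u1 ut].
by apply: (plane_backward fr psd1 psd2 e22 e12 e_res u0 E_opt);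
  rewrite ?Ve1 ?Ve2.
Qed.

(** In an orthonormal frame of [supp g1], the rank-one block [X] is diagonalised by a unit vector
    [e1] of its kernel and a unit vector [e2] orthogonal to it; [phi] and [phip] are their
    images. *)
Lemma criterion_necessary : \rank E1 = 1%N -> \rank E2 = 2%N ->
  exists phi phip : 'cV[C]_(2 + 2),
    [/\ onb2_of (in_supp g1) phi phip,
        0 <= sandwich phi (g2 - g1) phi,
        sqrtC (sandwich phip g1 phip) * sandwich phip g2 phi
          = sqrtC (sandwich phip g2 phip) * sandwich phip g1 phi
      & sandwich phip ((opK g1 g2 phip)^H *m opK g1 g2 phip) phip < 1].
Proof.
move=> rE1 rE2; have [r1 r2] := general_position_rank.
have [S [SS eqS]] := orthonormal_row_basis r1.
pose V : 'M[C]_(2 + 2, 2) := S^H.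
have VV : V^H *m V = 1%:M by rewrite adjointK.
have Vsupp (x : 'cV_2) : in_supp g1 (V *m x).
  apply/(in_suppP _ psd1); have : (S <= g1)%MS by rewrite eqS.
  case/submxP => B SE; exists (B^H *m x).
  by rewrite /V SE adjointM (psd_adjoint psd1) mulmxA.
have suppV w : in_supp g1 w -> w = V *m (V^H *m w).
  move/(in_suppP _ psd1) => [z ->]; have : (g1 <= S)%MS by rewrite eqS.
  case/submxP => B g1E.
  have -> : g1 = V *m B^H by rewrite -[g1](psd_adjoint psd1) g1E adjointM.
  by rewrite !mulmxA -(mulmxA V V^H) VV mulmx1.
have [W [A [D [T fr]]]] := usd_frame_exists psd1 psd2 ker_ker supp_ker r1 r2 VV Vsupp.
have E_usd := proj1 E_opt.
set X := V^H *m E1 *m V; have pX : psd X := usd_psdX E_opt.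
have rX : \rank X = 1%N by rewrite -(rank_usd_E1 fr psd2 E_opt).
have [e1 [e11 Xe1]] : exists e : 'cV[C]_2, e^H *m e = 1%:M /\ X *m e = 0.
  by apply: orthonormal_ker; rewrite rX.
have rP : \rank (e1 *m e1^H) = 1%N.
  apply/eqP; rewrite eqn_leq lt0n mxrank_eq0; apply/andP; split.
    exact: leq_trans (mxrankM_maxr _ _) (rank_leq_row _).
  apply/eqP => /(congr1 (mulmx e1^H)) /(congr1 (mulmx^~ e1)).
  rewrite mulmx0 mul0mx !mulmxA e11 mul1mx e11 => /matrixP/(_ 0 0)/eqP.
  by rewrite !mxE oner_eq0.
(* [e2] is found in the kernel of the projector onto [e1]. *)
have [e2 [e22 Pe2]] : exists e : 'cV[C]_2, e^H *m e = 1%:M /\ e1 *m e1^H *m e = 0.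
  by apply: orthonormal_ker; rewrite rP.
have e12 : e1^H *m e2 = 0.
  by rewrite -[LHS]mul1mx -e11 -mulmxA (mulmxA e1) Pe2 mulmx0.
have e21 : e2^H *m e1 = 0 by rewrite -[LHS]adjointK adjointM adjointK e12 adjoint0.
have e_res : e1 *m e1^H + e2 *m e2^H = 1%:M :> 'M[C]_(1 + 1).
  rewrite -mul_row_col; apply: mulmx1C.
  by rewrite mul_col_row e11 e12 e21 e22 -scalar_mx_block.
have bE (x y : 'cV[C]_2) a : x^H *m y = a%:M -> braket x y = a.
  by rewrite /braket => ->; rewrite mxE eqxx mulr1n.
have b11 := bE _ _ _ e11; have b22 := bE _ _ _ e22.
have b12 : braket e1 e2 = 0 by rewrite /braket e12 mxE.
set p := sandwich e2 X e2.
have XE : X = p *: (e2 *m e2^H).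
  rewrite -[LHS]mulmx1 -e_res mulmxDr !mulmxA Xe1 mul0mx add0r.
  rewrite -[X *m e2]mul1mx -e_res mulmxDl -!(mulmxA _ _ (X *m e2)) !(mulmxA _ X).
  rewrite -{1}(psd_adjoint pX) -adjointM Xe1 adjoint0 mul0mx mulmx0 add0r.
  by rewrite sandwich_mx mul_mx_scalar -scalemxAl.
have p0 : 0 < p.
  rewrite lt0r pX andbT; apply/eqP => p0; move/eqP: rX.
  by rewrite XE p0 scale0r mxrank0.
have [u uE] : exists u, u = 1 - p by exists (1 - p).
have pE : p = 1 - u by rewrite uE subKr.
have uU : 1%:M - X \in unitmx := usd_unitU fr psd1 psd2 E_opt.
have Ue2 : (1%:M - X) *m e2 = u *: e2.
  rewrite XE mulmxBl mul1mx -scalemxAl plane_proj2 // -[X in X - _]scale1r.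
  by rewrite -scalerBl -uE.
have e2n : e2 != 0.
  by apply/eqP => e20; move/eqP: b22; rewrite e20 braket0l eq_sym oner_eq0.
(* [u] is the eigenvalue at [e2] of [1 - X], which is positive and invertible. *)
have u0 : 0 < u.
  rewrite lt0r; apply/andP; split.
    apply/eqP => u0; move/eqP: e2n; apply.
    by rewrite -[e2](mulKmx uU) Ue2 u0 scale0r mulmx0.
  have := usd_psdU fr psd1 psd2 E_opt e2.
  by rewrite /sandwich Ue2 braketZr b22 mulr1.
have u1 : u < 1 by rewrite -subr_gt0 -pE.
have uY : W^H *m E2 *m W \in unitmx.
  by rewrite -row_free_unit /row_free -(rank_usd_E2 fr psd1 E_opt) rE2.
rewrite pE in XE.
have [G11 K21 K22 ut] := plane_forward fr psd1 psd2 b22 b12 u0 E_opt XE u1 uY.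
have phi2 : braket (V *m e2) (V *m e2) = 1 by rewrite braket_mull mulmxA VV mul1mx.
have phi1 : braket (V *m e1) (V *m e1) = 1 by rewrite braket_mull mulmxA VV mul1mx.
have phi12 : braket (V *m e1) (V *m e2) = 0 by rewrite braket_mull mulmxA VV mul1mx.
exists (V *m e1), (V *m e2).
have phi0 : V *m e2 != 0.
  by apply/eqP => h; move/eqP: phi2; rewrite h braket0l eq_sym oner_eq0.
have [g22 k22] := general_position_gt0 (Vsupp e2) phi0.
split.
- split=> // w /suppV wE; exists (braket e1 (V^H *m w)), (braket e2 (V^H *m w)).
  rewrite {1}wE -[V^H *m w in LHS]mul1mx -e_res mulmxDl mulmxDr.
  by rewrite -!(mulmxA _ _ (V^H *m w)) !braket_mx !mul_mx_scalar !scalemxAr.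
- exact: G11.
- rewrite K21 K22 sqrtCM ?nnegrE ?exprn_ge0 ?ltW // exprCK ?ltW //.
  by ring.
have ru : ratio_r g1 g2 (V *m e2) = u.
  by rewrite /ratio_r K22 mulfK ?gt_eqF // exprCK // ltW.
rewrite (plane_K fr b22 u0 ru general_position_unit) criterion_scalar //.
  by rewrite u1.
exact: braket_ge0.
Qed.

End Criterion.

Theorem mainTheorem5 (R : realType) (g1 g2 : 'M[R[i]]_4)
  (g1_psd : psd g1) (g2_psd : psd g2)
  (supp_supp : trivial_meet (in_supp g1) (in_supp g2))
  (ker_ker : trivial_meet (in_ker g1) (in_ker g2))
  (supp_ker : trivial_meet (in_supp g1) (in_ker g2))
  (ker_supp : trivial_meet (in_ker g1) (in_supp g2))
  (E1 E2 Eq : 'M[R[i]]_4) (E_opt : optimal_usd g1 g2 E1 E2 Eq) :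
  (\rank E1 = 1%N /\ \rank E2 = 2%N) <->
  exists phi phip : 'cV[R[i]]_4,
    [/\ onb2_of (in_supp g1) phi phip,
        0 <= sandwich phi (g2 - g1) phi,
        sqrtC (sandwich phip g1 phip) * sandwich phip g2 phi
          = sqrtC (sandwich phip g2 phip) * sandwich phip g1 phi
      & sandwich phip (adjoint (opK g1 g2 phip) *m opK g1 g2 phip) phip < 1].
Proof.
split=> [[r1 r2] | [phi [phip [onb c1 c2 c3]]]].
  exact: (criterion_necessary g1_psd g2_psd supp_supp ker_ker supp_ker ker_supp
            E_opt r1 r2).
exact: (criterion_sufficient g1_psd g2_psd supp_supp ker_ker supp_ker ker_supp
          E_opt onb c1 c2 c3).
Qed.
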